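(* Let $k\ge 1$ be a fixed integer. Then, as $n\to\infty$, $$\mathbf E[\mathcal X_{n,r}]\sim \eta_{k,r}\,n^{1-\frac rk}\quad (1\le r<k),\qquad \mathbf E[\mathcal X_{n,k}]\sim \log n ,$$ where $$\eta_{k,r}=\frac{(k!)^{r/k}}{k-r}\,\frac{\Gamma(r/k)}{\Gamma(r)} .$$ Therefore $\mathbf E[\mathcal X_n]\sim\mathbf E[\mathcal X_{n,1}]$. Also, for $k=2$, $\mathbf E[\mathcal X_n]\sim\mathbf E[\mathcal X_{n,1}]\sim\sqrt{2\pi n}$.
   Context: Let $(T_{i,j})_{i\ge1,j\ge1}$ be i.i.d. exponential random variables of mean $1$, and let $G_{r,j}=\sum_{i=1}^{r}T_{i,j}$. Consider a path with nodes $1,2,\dots,n$, where $1$ is the root and $n$ is the leaf (the ancestors of $j$ are $1,\dots,j-1$). For $1\le r\le k$, node $j$ is an $r$-record if $G_{r,j}<\min\{G_{k,i}:1\le i<j\}$ (with $\min\emptyset=+\infty$); $I_{r,j}\in\{0,1\}$ is the indicator of this event. Let $\mathcal X_{n,r}=\sum_{j=1}^{n}I_{r,j}$ be the number of $r$-records and $\mathcal X_n=\sum_{r=1}^{k}\mathcal X_{n,r}$ (the $k$-cut number of the path). $\Gamma$ is the gamma function, and $a_n\sim b_n$ means $a_n/b_n\to1$ as $n\to\infty$. *)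

(* Defs.v *)
From HB Require Import structures.
From mathcomp Require Import all_boot all_order all_algebra.
From mathcomp Require Import all_classical all_reals all_analysis.

Set Implicit Arguments.
Unset Strict Implicit.
Unset Printing Implicit Defensive.

Import Order.TTheory GRing.Theory Num.Theory.
Import numFieldNormedType.Exports.

Local Open Scope classical_set_scope.
Local Open Scope ring_scope.

(* Mutual independence of the subfamily (X i), i in D: the product rule over
   every finite set of indices of D, listed without repetition by s. *)
Definition mutually_independent d (Omega : measurableType d) (R : realType)
    (P : probability Omega R) (I : eqType) (D : set I)
    (X : I -> {RV P >-> R}) : Prop :=
  forall (s : seq I) (A : I -> set R),
    uniq s -> [set` s] `<=` D -> (forall i, measurable (A i)) ->
    (P (\bigcap_(i in [set` s]) (X i @^-1` A i))
     = \prod_(i <- s) P (X i @^-1` A i))%E.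

Definition has_exponential_law d (Omega : measurableType d) (R : realType)
    (P : probability Omega R) (rate : R) (X : {RV P >-> R}) : Prop :=
  forall A : set R, measurable A ->
    distribution P X A = exponential_prob rate A.

(* The exponential law of mean 1 is the one of rate 1.  Indices start at 1:
   nothing is assumed about T 0 j and T i 0, which are never used. *)
Definition iid_exp1 d (Omega : measurableType d) (R : realType)
    (P : probability Omega R) (T : nat -> nat -> {RV P >-> R}) : Prop :=
  mutually_independent [set ij : nat * nat | (1 <= ij.1)%N /\ (1 <= ij.2)%N]
    (fun ij => T ij.1 ij.2) /\
  (forall i j : nat, (1 <= i)%N -> (1 <= j)%N ->
     has_exponential_law 1 (T i j)).

Section kcut_path.
Context d (Omega : measurableType d) (R : realType) (P : probability Omega R).
Variables (T : nat -> nat -> {RV P >-> R}) (k : nat).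

Definition cut_time (r j : nat) (w : Omega) : R :=
  \sum_(1 <= i < r.+1) T i j w.

(* The minimum is taken in the extended reals so that it is +oo for j = 1. *)
Definition is_record (r j : nat) (w : Omega) : bool :=
  ((cut_time r j w)%:E <
   \big[Order.min/+oo]_(1 <= i < j) (cut_time k i w)%:E)%E.

Definition num_records (n r : nat) (w : Omega) : R :=
  \sum_(1 <= j < n.+1) (is_record r j w)%:R.

Definition kcut_number (n : nat) (w : Omega) : R :=
  \sum_(1 <= r < k.+1) num_records n r w.

(* [fine] only changes the type: the variables above take values in [0, n]
   and [0, k n], so their expectations are finite. *)
Definition mean_records (n r : nat) : R := fine 'E_P[num_records n r].

Definition mean_kcut (n : nat) : R := fine 'E_P[kcut_number n].

End kcut_path.

(* Euler's integral; meaningful for x > 0. *)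
Definition Gamma (R : realType) (x : R) : R :=
  \int[lebesgue_measure]_(t in `]0, +oo[) (t `^ (x - 1) * expR (- t)).

Definition kcut_eta (R : realType) (k r : nat) : R :=
  (k`!%:R `^ (r%:R / k%:R)) / (k%:R - r%:R)
  * (Gamma (r%:R / k%:R) / Gamma (r%:R)).

(* x / 0 = 0 here, which only matters for the finitely many n at which the
   denominators considered vanish (e.g. ln n at n = 0, 1). *)
Definition asymp_eq (R : realType) (a b : nat -> R) : Prop :=
  a n / b n @[n --> \oo] --> (1 : R).

(* Main.v *)
(* Condition on the value x of G_{r,j+1}.  Writing S(x) = e^-x sum_(i<k) x^i/i!
   for the tail of G_k, node j+1 is an r-record with probability
     a_j = int_0^oo x^(r-1)/(r-1)! e^-x S(x)^j dx.
   For r = k the integrand is the derivative of - S^(j+1)/(j+1), so that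
   a_j = 1/(j+1).  For r < k, the bounds
     exp(- x^k/k!) <= S(x) <= exp(- e^-x x^k/k!)
   squeeze a_j between integrals int_0^oo x^(r-1) exp(- lam x^k) dx, which the
   substitution t = lam x^k turns into values of the Gamma function; hence
   a_j j^(r/k) converges.  The Stolz-Cesaro theorem, against n^(1-r/k) and
   against ln n, then gives the asymptotics of the sums of the a_j. *)

Require Import Defs.
From HB Require Import structures.
From mathcomp Require Import all_boot all_order all_algebra.
From mathcomp Require Import all_classical all_reals all_analysis.
From mathcomp Require Import measurable_realfun.
From mathcomp Require Import ring lra.

Import Order.TTheory GRing.Theory Num.Theory.
Import numFieldNormedType.Exports.

Local Open Scope classical_set_scope.
Local Open Scope ring_scope.

(** * Independence *)

(** The hypothesis is a product rule for single variables [T i j], while conditioning needs the cut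
    time of node j+1 to be independent of the minimum over the nodes 1..j. Finite intersections of
    events about single variables form a pi-system, so the rule extends to the sigma-algebras of
    disjoint index blocks; conditioning is then a computation with a product measure. For r < k only
    x of order j^(-1/k) matters, so both factors e^-x, that of the density and that in the exponent
    of the upper bound, should behave like 1. Below, the one in the density is replaced by 1 - x, at
    the cost of an integral of the next order, smaller by j^(-1/k). Above, it is replaced by 1, and
    the one in the exponent by e^-delta on [0, delta]. The limit of a_j j^(r/k) exists for r = k
    too. This single statement makes every order r >= 2 negligible against n^(1-1/k), the
    logarithmic one included. Only k = 1, where 1-records are k-records, is treated apart. *)

Lemma indep_g_sigma_algebral {d} {Omega : measurableType d} {R : realType}
    (P : probability Omega R) (G : set (set Omega)) (B : set Omega) :
  G `<=` measurable -> setI_closed G -> G setT -> measurable B ->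
  (forall A, G A -> P (A `&` B) = P A * P B)%E ->
  forall A, <<s G >> A -> (P (A `&` B) = P A * P B)%E.
Proof.
move=> Gm GI GT mB GB A sGA.
have PB0 : 0 <= fine (P B) by rewrite fine_ge0.
have mscaleE C : mscale (NngNum PB0) P C = (P B * P C)%E.
  by rewrite /mscale /= fineK// fin_num_measure.
transitivity (mscale (NngNum PB0) P A); last by rewrite mscaleE muleC.
(* The finite measures C |-> P (C [&] B) and P B * P agree on the pi-system [G]; since [G] contains
   [setT], the constant sequence [setT] serves as the exhaustion required by uniqueness. *)
apply: (@g_sigma_algebra_measure_unique _ R Omega G Gm (fun=> setT) (fun=> GT)
  _ (mrestr P mB) (mscale (NngNum PB0) P) GI _ _ A sGA).
- exact: bigcup_const.
- by move=> C GC; rewrite /= mscaleE muleC; exact: GB.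
- by move=> _; rewrite /= /mrestr setTI ltey_eq fin_num_measure.
Qed.

Lemma indep_g_sigma_algebra {d} {Omega : measurableType d} {R : realType}
    (P : probability Omega R) (G H : set (set Omega)) :
  G `<=` measurable -> setI_closed G -> G setT ->
  H `<=` measurable -> setI_closed H -> H setT ->
  (forall A B, G A -> H B -> P (A `&` B) = P A * P B)%E ->
  forall A B, <<s G >> A -> <<s H >> B -> (P (A `&` B) = P A * P B)%E.
Proof.
move=> Gm GI GT Hm HI HT GH A B sGA sHB.
have mA : measurable A.
  by move: A sGA; apply: smallest_sub => //; exact: sigma_algebra_measurable.
(* One side is extended at a time: first from [H] with [A] fixed, then from [G] with [B] in [H]
   fixed. *)
rewrite setIC muleC; apply: (indep_g_sigma_algebral P H) => // {sHB}B HB.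
rewrite setIC muleC; apply: (indep_g_sigma_algebral P G) => //.
- exact: Hm.
- by move=> C GC; exact: GH.
Qed.

Section grouping.
Context {d} {Omega : measurableType d} {R : realType} {P : probability Omega R}.
Context {I : choiceType} (X : I -> {RV P >-> R}).

(** Finite intersections, rather than single preimages, make this generator of the sigma-algebra of
    the X i, i in D, a pi-system. *)
Definition cylinders (D : set I) : set (set Omega) :=
  [set C | exists (s : seq I) (A : I -> set R), [/\ uniq s, [set` s] `<=` D,
    forall i, measurable (A i) & C = \bigcap_(i in [set` s]) (X i @^-1` A i)]].

Lemma cylinders_measurable D : cylinders D `<=` measurable.
Proof.
move=> _ [s [A [us _ mA ->]]]; rewrite bigcap_seq.
by apply: bigsetI_measurable => i _; exact: measurable_funPTI.
Qed.

Lemma cylinders_setT D : cylinders D setT.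
Proof. by exists [::], (fun=> setT); split=> //;
  rewrite set_nil bigcap_set0. Qed.

Lemma cylinders_setI D : setI_closed (cylinders D).
Proof.
move=> _ _ [s [A [us sD mA ->]]] [t [B [ut tD mB ->]]].
(* An index occurring in only one of the lists gets the trivial constraint [setT] from the other. *)
exists (undup (s ++ t)), (fun i => (if i \in s then A i else setT) `&`
                                  (if i \in t then B i else setT)).
split; first exact: undup_uniq.
- by move=> i /=; rewrite mem_undup mem_cat => /orP[/sD|/tD].
- by move=> i; apply: measurableI; case: ifP.
- apply/seteqP; split=> [w [Aw Bw] i /= _|w ABw].
    by split; case: ifPn => // ?; [exact: Aw|exact: Bw].
  split=> i /= it; have := ABw i; rewrite /= mem_undup mem_cat it ?orbT.
    by move=> /(_ isT)[].
  by move=> /(_ isT)[].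
Qed.

Lemma cylinders_preimage {D i A} : D i -> measurable A ->
  cylinders D (X i @^-1` A).
Proof.
move=> Di mA; exists [:: i], (fun=> A); split=> //.
- by move=> j /=; rewrite inE => /eqP ->.
- by rewrite set_cons1 bigcap_set1.
Qed.

Lemma mutually_independent_cylinders {D D1 D2 : set I} :
  mutually_independent D X -> D1 `<=` D -> D2 `<=` D -> D1 `&` D2 = set0 ->
  forall A B, <<s cylinders D1 >> A -> <<s cylinders D2 >> B ->
  (P (A `&` B) = P A * P B)%E.
Proof.
move=> iX D1D D2D D120; apply: indep_g_sigma_algebra;
  do ?[exact: cylinders_measurable|exact: cylinders_setI|exact: cylinders_setT].
move=> _ _ [s [A [us sD mA ->]]] [t [B [ut tD mB ->]]].
(* As [s] and [t] are disjoint, [C] glues the two families, and the product rule on [s ++ t] splits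
   into the two products. *)
pose C i := if i \in s then A i else B i.
have st i : i \in t -> (i \in s) = false.
  move=> it; apply/negP => si; suff : set0 i by [].
  by rewrite -D120; split; [exact: sD|exact: tD].
have mC i : measurable (C i) by rewrite /C; case: ifP.
rewrite (_ : _ `&` _ = \bigcap_(i in [set` s ++ t]) (X i @^-1` C i));
  last first.
  rewrite /C; apply/seteqP; split=> [w [Aw Bw] i /=|w Cw].
    by rewrite mem_cat; case: ifPn => [si _|_ /=]; [exact: Aw|exact: Bw].
  split=> i /= si; have := Cw i; rewrite /= mem_cat si ?orbT /=.
    exact.
  by rewrite st//; exact.
rewrite iX//; last 2 first.
- rewrite cat_uniq us ut andbT/=; apply/hasPn => i it; by rewrite /= st.
- by move=> i /=; rewrite mem_cat => /orP[/sD/D1D|/tD/D2D].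
rewrite iX//; last by move=> i /sD/D1D.
rewrite iX//; last by move=> i /tD/D2D.
rewrite big_cat/=; congr (_ * _)%E; apply: eq_big_seq => i.
  by rewrite /C => ->.
by rewrite /C => /st ->.
Qed.

End grouping.

(** Independence makes the joint law a product measure, and a product measure integrates its
    sections: this is conditioning on the value of [X]. *)
Lemma indep_pair_prob {d d1 d2} {Omega : measurableType d}
    {T1 : measurableType d1} {T2 : measurableType d2} {R : realType}
    {P : probability Omega R} {X : {RV P >-> T1}} {Y : {RV P >-> T2}} :
  (forall A B, measurable A -> measurable B ->
    P ((X @^-1` A) `&` (Y @^-1` B)) = P (X @^-1` A) * P (Y @^-1` B))%E ->
  forall C : set (T1 * T2), measurable C ->
  (P [set w | C (X w, Y w)] =
   \int[distribution P X]_x P (Y @^-1` xsection C x))%E.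
Proof.
move=> XY C mC.
pose Z := fun w => (X w, Y w).
have mZ : measurable_fun setT Z by exact: measurable_fun_pair.
pose Z' : {RV P >-> (T1 * T2)%type} := mfun_Sub (mem_set mZ).
have := @product_measure_unique _ _ _ _ R (distribution P X) (distribution P Y)
  (distribution P Z').
move=> /(_ _ C mC) H.
transitivity (distribution P Z' C); first by [].
rewrite -H//.
Qed.

(** * Measures with a density *)

Section density.
Import HBNNSimple.
Context {d} {T : measurableType d} {R : realType}.
Context (mu : {measure set T -> \bar R}) {g : T -> R}.
Hypotheses (g0 : forall x, 0 <= g x) (mg : measurable_fun setT g).
Local Open Scope ereal_scope.

Definition with_density (A : set T) : \bar R := \int[mu]_(x in A) (g x)%:E.

Let with_density0 : with_density set0 = 0.
Proof. by rewrite /with_density integral_set0. Qed.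

Let with_density_ge0 A : 0 <= with_density A.
Proof. by apply: integral_ge0 => x _; rewrite lee_fin. Qed.

Let with_density_sigma_additive : semi_sigma_additive with_density.
Proof.
move=> F mF tF mUF; rewrite /with_density; apply: cvg_toP.
  apply: ereal_nondecreasing_is_cvgn => m n mn.
  by apply: lee_sum_nneg_natr => // k _ _; apply: with_density_ge0.
rewrite ge0_integral_bigcup//=.
- by apply: (@measurable_funTS _ _ _ _ _ (EFin \o g)); exact/measurable_EFinP.
- by move=> x _; rewrite lee_fin.
Qed.

HB.instance Definition _ := isMeasure.Build _ _ _
  with_density with_density0 with_density_ge0 with_density_sigma_additive.

Definition density_measure : {measure set T -> \bar R} := with_density.

(** Monotone convergence along simple functions reduces both sides to values of [nu] on level sets.
    Only these values are compared, so [nu] may be the law of a random variable. *)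
Lemma ge0_integral_density (nu : {measure set T -> \bar R}) (f : T -> \bar R) :
  (forall A, measurable A -> nu A = \int[mu]_(x in A) (g x)%:E) ->
  measurable_fun setT f -> (forall x, 0 <= f x) ->
  \int[nu]_x f x = \int[mu]_x (f x * (g x)%:E).
Proof.
move=> nuE mf f0.
pose h := nnsfun_approx measurableT mf.
have mgE : measurable_fun setT (EFin \o g) by exact/measurable_EFinP.
have -> : \int[nu]_x f x = lim (\int[nu]_x (h n x)%:E @[n --> \oo]).
  under eq_integral => x _.
    have -> : f x = lim ((h n x)%:E @[n --> \oo]).
      by apply/esym/cvg_lim => //; exact: cvg_nnsfun_approx.
    over.
  apply: monotone_convergence => //.
  - by move=> n; exact/measurable_EFinP.
  - by move=> n x _ /=; rewrite lee_fin.
  - by move=> x _ a b ab; rewrite lee_fin; exact/lefP/nd_nnsfun_approx.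
have -> : \int[mu]_x (f x * (g x)%:E) =
    lim (\int[mu]_x ((h n x)%:E * (g x)%:E) @[n --> \oo]).
  under eq_integral => x _.
    have -> : f x * (g x)%:E = lim ((h n x)%:E * (g x)%:E @[n --> \oo]).
      apply/esym/cvg_lim => //; apply: cvgeZr => //.
      exact: cvg_nnsfun_approx.
    over.
  apply: monotone_convergence => //.
  - by move=> n; apply/emeasurable_funM => //; exact/measurable_EFinP.
  - by move=> n x _ /=; rewrite mule_ge0 ?lee_fin.
  - move=> x _ a b ab; rewrite lee_wpmul2r ?lee_fin//.
    exact/lefP/nd_nnsfun_approx.
congr (lim (_ @ \oo)); apply/funext => n.
transitivity (\int[nu]_x
   (\sum_(y \in range (h n)) (y * \1_(h n @^-1` [set y]) x)%:E)).
  by apply: eq_integral => t _; rewrite /= fimfunE -fsumEFin.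
have indich r : measurable_fun setT (fun x => (r * \1_(h n @^-1` [set r])
  x)%:E).
  by apply/measurable_EFinP; exact: measurable_funM.
rewrite ge0_integral_fsum//; last by move=> m y Ey; exact: nnfun_muleindic_ge0.
transitivity (\int[mu]_x (\sum_(y \in range (h n))
    (y * \1_(h n @^-1` [set y]) x)%:E * (g x)%:E)); last first.
  apply: eq_integral => x _.
  rewrite -ge0_mule_fsuml => [|y]; last exact: nnfun_muleindic_ge0.
  by rewrite fsumEFin // -(fimfunE _ x).
rewrite ge0_integral_fsum//; last 2 first.
- by move=> y; apply: emeasurable_funM.
- by move=> m y Ey; rewrite mule_ge0 ?lee_fin// -lee_fin nnfun_muleindic_ge0.
apply: eq_fsbigr => r rhn.
under eq_integral do rewrite EFinM.
rewrite integralZl_indic_nnsfun => //.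
under [RHS]eq_integral do rewrite EFinM -muleA.
rewrite ge0_integralZl//.
- under [in RHS]eq_integral do rewrite muleC.
  rewrite [in RHS](eq_integral ((EFin \o g) \_ (h n @^-1` [set r])));
    last first.
    by move=> x xE; rewrite epatch_indic.
  by rewrite -integral_mkcond -nuE// integral_indic// setIT.
- apply: emeasurable_funM => //; exact/measurable_EFinP.
- by move=> t Et; rewrite mule_ge0 ?lee_fin.
- by move: rhn; rewrite inE => -[t _ <-]; rewrite lee_fin.
Qed.

End density.

(** * Erlang distributions *)

Section erlang.
Context {R : realType}.
Implicit Types (r k : nat) (x : R).

Definition exp_sum r x : R := \sum_(i < r) x ^+ i / i`!%:R.

(* The tail of the sum of [r] exponential variables, for [0 <= x]. *)
Definition erlang_tail r x : R := expR (- x) * exp_sum r x.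

(* The density of the sum of [r.+1] exponential variables, for [0 <= x]. *)
Definition erlang_pdf r x : R := x ^+ r / r`!%:R * expR (- x).

Lemma exp_sumS r x : exp_sum r.+1 x = exp_sum r x + x ^+ r / r`!%:R.
Proof. by rewrite /exp_sum big_ord_recr. Qed.

Lemma exp_sumS0 r : exp_sum r.+1 0 = 1 :> R.
Proof.
rewrite /exp_sum big_ord_recl /= expr0 invr1 mulr1 big1 ?addr0// => i _.
by rewrite expr0n mul0r.
Qed.

Lemma is_derive_exprn r x :
  is_derive x 1 (fun y : R => y ^+ r) (r%:R * x ^+ r.-1).
Proof.
have := @is_deriveX _ _ id r x 1 1 _.
by rewrite exprfctE /GRing.scale /= mulr1; apply.
Qed.

Lemma is_derive_monomial r x :
  is_derive x 1 (fun y : R => y ^+ r.+1 / (r.+1)`!%:R) (x ^+ r / r`!%:R).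
Proof.
have := @is_deriveM _ _ _ _ x 1 _ _ (is_derive_exprn r.+1 x)
  (is_derive_cst ((r.+1)`!%:R^-1 : R) x 1).
move=> /is_derive_eq; apply.
rewrite scaler0 add0r /= factS natrM invfM /GRing.scale /=.
have : (r.+1%:R : R) != 0 by rewrite pnatr_eq0.
have : (r`!%:R : R) != 0 by rewrite pnatr_eq0 -lt0n fact_gt0.
by move=> *; field; apply/andP; split.
Qed.

Lemma is_derive_exp_sum r x : is_derive x 1 (exp_sum r.+1) (exp_sum r x).
Proof.
elim: r => [|r IH].
  have -> : exp_sum 1 = cst 1.
    by apply/funext => y; rewrite /exp_sum big_ord1 expr0 invr1 mulr1.
  by rewrite /exp_sum big_ord0; exact: is_derive_cst.
have -> : exp_sum r.+2 = exp_sum r.+1 + (fun y : R => y ^+ r.+1 / (r.+1)`!%:R).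
  by apply/funext => y; rewrite exp_sumS.
by rewrite exp_sumS; apply: is_deriveD; exact: is_derive_monomial.
Qed.

Lemma is_derive_expRN x : is_derive x 1 (fun y : R => expR (- y)) (- expR (-
  x)).
Proof.
have := is_derive1_comp (is_derive_expR (- x)) (is_deriveNid x 1).
by rewrite mulrN1.
Qed.

(** The two terms of the product rule are consecutive partial sums of the exponential series, so
    only the top monomial survives. *)
Lemma is_derive_erlang_tail r x :
  is_derive x 1 (erlang_tail r.+1) (- erlang_pdf r x).
Proof.
have := @is_deriveM _ _ _ _ x 1 _ _ (is_derive_expRN x) (is_derive_exp_sum r x).
move=> /is_derive_eq; apply.
by rewrite exp_sumS /erlang_pdf /GRing.scale /=; ring.
Qed.

Lemma erlang_tail0 r : erlang_tail r.+1 0 = 1 :> R.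
Proof. by rewrite /erlang_tail oppr0 expR0 exp_sumS0 mulr1. Qed.

Lemma erlang_pdf_ge0 r x : 0 <= x -> 0 <= erlang_pdf r x.
Proof. by move=> x0; rewrite !mulr_ge0 ?expR_ge0 ?exprn_ge0// invr_ge0. Qed.

Lemma exp_sum_ge1 r x : 0 <= x -> 1 <= exp_sum r.+1 x.
Proof.
move=> x0; rewrite /exp_sum big_ord_recl /= expr0 invr1 mulr1 lerDl.
by apply: sumr_ge0 => i _; rewrite mulr_ge0 ?exprn_ge0 ?invr_ge0.
Qed.

Lemma is_derive_continuous (f : R -> R) (df x : R) :
  is_derive x 1 f df -> {for x, continuous f}.
Proof.
by move=> [dfx _]; apply: differentiable_continuous; exact/derivable1_diffP.
Qed.

Lemma continuous_erlang_tail r : continuous (@erlang_tail r.+1).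
Proof. by move=> x; exact: is_derive_continuous (is_derive_erlang_tail r x).
  Qed.

Lemma continuous_expRN : continuous (fun x : R => expR (- x)).
Proof. by move=> x; exact: is_derive_continuous (is_derive_expRN x). Qed.

Lemma continuous_erlang_pdf r : continuous (@erlang_pdf r).
Proof.
move=> x; have := is_deriveM (is_deriveM (is_derive_exprn r x)
  (is_derive_cst (r`!%:R^-1 : R) x 1)) (is_derive_expRN x).
exact: is_derive_continuous.
Qed.

Lemma is_derive_ge0_le (f df : R -> R) (a b : R) : a <= b ->
  (forall x, a <= x -> is_derive x 1 f (df x)) ->
  (forall x, a <= x -> 0 <= df x) -> f a <= f b.
Proof.
move=> ab fdf df0; rewrite -subr_ge0.
have [x /[!in_itv]/= /andP[ax _]||c] := @MVT_segment R f df a b ab.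
- exact/fdf/ltW.
- apply: derivable_within_continuous => x /[!in_itv]/= /andP[ax _].
  by have [] := fdf _ ax.
rewrite in_itv/= => /andP[ac _] ->.
by rewrite mulr_ge0 ?df0 ?subr_ge0.
Qed.

Lemma erlang_tail_le1 r x : 0 <= x -> erlang_tail r.+1 x <= 1.
Proof.
move=> x0; rewrite -lerN2 -[in leLHS](erlang_tail0 r).
apply: (is_derive_ge0_le (fun y => - erlang_tail r.+1 y) (erlang_pdf r)) => //.
  move=> y y0; rewrite -[erlang_pdf _ _]opprK.
  exact: is_deriveN (is_derive_erlang_tail r y).
exact: erlang_pdf_ge0.
Qed.

Lemma erlang_tail_ge0 r x : 0 <= x -> 0 <= erlang_tail r x.
Proof.
move=> x0; rewrite mulr_ge0 ?expR_ge0// sumr_ge0// => i _.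
by rewrite mulr_ge0 ?exprn_ge0 ?invr_ge0.
Qed.

(** The tail of order k+1 is at most 1 and exceeds that of order k by u = e^-x x^k/k!; hence the
    latter is at most 1 - u <= e^-u. *)
Lemma erlang_tail_le_expR k x : 0 <= x ->
  erlang_tail k x <= expR (- (expR (- x) * (x ^+ k / k`!%:R))).
Proof.
move=> x0; apply: le_trans (expR_ge1Dx _).
have := erlang_tail_le1 k x x0; rewrite /erlang_tail exp_sumS mulrDr.
by rewrite lerBrDr.
Qed.

(* The logarithmic derivative of the tail is [- x ^ k / k! / exp_sum k.+1 x],
   which is at least [- x ^ k / k!]. *)
Lemma expR_le_erlang_tail k x : 0 <= x ->
  expR (- (x ^+ k.+1 / (k.+1)`!%:R)) <= erlang_tail k.+1 x.
Proof.
move=> x0; pose m (y : R) : R := y ^+ k.+1 / (k.+1)`!%:R.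
rewrite -/(m x) expRN -[leLHS]mul1r ler_pdivrMr ?expR_gt0//.
have -> : 1 = (erlang_tail k.+1 * (expR \o m)) 0 :> R.
  by rewrite fctE /= /m expr0n mul0r expR0 erlang_tail0 mulr1.
pose df y := erlang_tail k.+1 y * (y ^+ k / k`!%:R * expR (m y))
             + expR (m y) * (- erlang_pdf k y).
apply: (is_derive_ge0_le (erlang_tail k.+1 * (expR \o m)) df) => // y y0.
  have mE := is_derive1_comp (is_derive_expR _) (is_derive_monomial k y).
  have := @is_deriveM _ _ _ _ y 1 _ _ (is_derive_erlang_tail k y) mE.
  by move=> /is_derive_eq; apply; rewrite /df /GRing.scale /=; ring.
have -> : df y = y ^+ k / k`!%:R * expR (m y) * expR (- y) * (exp_sum k.+1 y -
  1).
  by rewrite /df /erlang_tail /erlang_pdf; ring.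
by rewrite !mulr_ge0 ?expR_ge0 ?exprn_ge0 ?invr_ge0 ?subr_ge0 ?exp_sum_ge1.
Qed.

End erlang.

(** * Integrals of Erlang densities and tails *)

Section erlang_integral.
Context {R : realType}.
Notation mu := (@lebesgue_measure R).

Lemma measurable_erlang_pdf r (D : set R) : measurable_fun D (@erlang_pdf R r).
Proof.
apply: measurable_funTS; apply: continuous_measurable_fun.
exact: continuous_erlang_pdf.
Qed.

(** This is Markov's inequality for a sum of k exponential variables of mean 1. Termwise, x * x^i/i!
    = (i+1) x^(i+1)/(i+1)! with i+1 <= k. *)
Lemma erlang_tail_le_div k (x : R) : 0 < x -> erlang_tail k x <= k%:R / x.
Proof.
move=> x0; rewrite ler_pdivlMr// /erlang_tail -mulrA mulrC [_ * x]mulrC.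
have xE : x * exp_sum k x <= k%:R * exp_sum k.+1 x.
  rewrite /exp_sum big_ord_recl mulrDr mulr_sumr mulr_sumr -[leLHS]add0r.
  apply: lerD; first by rewrite expr0 invr1 !mulr1.
  apply: ler_sum => i _; rewrite lift0 mulrA -exprS factS natrM invfM.
  rewrite mulrCA ler_wpM2l ?exprn_ge0 ?(ltW x0)// mulrA.
  rewrite ler_peMl ?invr_ge0// ler_pdivlMr ?mul1r ?ler_nat ?ltr0n//.
apply: le_trans (_ : k%:R * (expR (- x) * exp_sum k.+1 x) <= _).
  by rewrite [leRHS]mulrCA mulrC ler_wpM2l ?expR_ge0.
by rewrite ler_piMr// erlang_tail_le1// ltW.
Qed.

Lemma cvg_erlang_tail k : erlang_tail k x @[x --> +oo%R] --> (0 : R).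
Proof.
apply: (@squeeze_cvgr _ _ _ _ (fun=> 0) (fun x : R => k%:R / x)).
- near=> x.
  have x0 : 0 < x by near: x; exact: nbhs_pinfty_gt.
  by rewrite erlang_tail_ge0 ?erlang_tail_le_div// ltW.
- exact: cvg_cst.
- rewrite -[0 in X in _ --> X](mulr0 k%:R); apply: cvgM; first exact: cvg_cst.
  apply/(@gtr0_cvgV0 _ _ _ _ id) => //; exact: nbhs_pinfty_gt.
Unshelve. all: by end_near. Qed.

Lemma integral_erlang_pdf r (a : R) : 0 <= a ->
  (\int[mu]_(x in `[a, +oo[) (erlang_pdf r x)%:E = (erlang_tail r.+1 a)%:E)%E.
Proof.
move=> a0.
rewrite (@ge0_continuous_FTC2y _ _ (fun x => - erlang_tail r.+1 x) _ 0).
- by rewrite sub0e -EFinN opprK.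
- by move=> x ax; rewrite erlang_pdf_ge0// (le_trans a0).
- by apply: continuous_subspaceT; exact: continuous_erlang_pdf.
- by rewrite -oppr0; apply: cvgN; exact: cvg_erlang_tail.
- by move=> x _; have [] := is_deriveN (is_derive_erlang_tail r x).
- by apply: cvg_at_right_filter; apply: cvgN; exact: continuous_erlang_tail.
- move=> x _; have := is_deriveN (is_derive_erlang_tail r x).
  by rewrite derive1E opprK => -[_].
Qed.

Lemma integral_erlang_pdf_tailX r n :
  (\int[mu]_(x in `[0%R, +oo[) (erlang_pdf r x * erlang_tail r.+1 x ^+ n)%:E
   = (n.+1%:R^-1)%:E)%E.
Proof.
pose F (x : R) := (- n.+1%:R^-1) * erlang_tail r.+1 x ^+ n.+1.
have dF (x : R) :
    is_derive x 1 F (erlang_pdf r x * erlang_tail r.+1 x ^+ n).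
  have := is_deriveM (is_derive_cst (- n.+1%:R^-1 : R) x 1)
    (is_derive1_comp (is_derive_exprn n.+1 _) (is_derive_erlang_tail r x)).
  move=> /is_derive_eq; apply; rewrite scaler0 addr0 /GRing.scale /=.
  have n0 : (n.+1%:R : R) != 0 by rewrite pnatr_eq0.
  by field.
rewrite (@ge0_continuous_FTC2y _ _ F _ 0).
- by rewrite /F erlang_tail0 expr1n mulr1 sub0e -EFinN opprK.
- move=> x x0; rewrite mulr_ge0 ?exprn_ge0 ?erlang_pdf_ge0//.
  exact: erlang_tail_ge0.
- apply: continuous_subspaceT => x; apply: continuousM.
    exact: continuous_erlang_pdf.
  apply: is_derive_continuous.
  exact: is_derive1_comp (is_derive_exprn n _) (is_derive_erlang_tail r x).
- suff : F x @[x --> +oo%R] --> - n.+1%:R^-1 * (0 : R) ^+ n.+1.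
    by rewrite expr0n mulr0.
  apply: cvgM; first exact: cvg_cst.
  apply: (@cvg_comp _ _ _ _ (fun x => x ^+ n.+1) _ _ _ (cvg_erlang_tail r.+1)).
  exact: exprn_continuous.
- by move=> x _; have [] := dF x.
- by apply: cvg_at_right_filter; exact: is_derive_continuous (dF 0).
- by move=> x _; rewrite derive1E; have [_] := dF x.
Qed.

End erlang_integral.

(** * Erlang laws on the whole line *)

Section erlang_law.
Context {R : realType}.
Notation mu := (@lebesgue_measure R).

Definition erlang_density r : R -> R := (erlang_pdf r) \_ `[0, +oo[.

(** For r = 0 this is the strict tail of the constant 0, since [erlang_tail 0] vanishes; the
    induction on the number of summands starts there. *)
Definition erlang_ccdf r (x : R) : R := if x < 0 then 1 else erlang_tail r x.

Lemma erlang_density_ge0 r x : 0 <= erlang_density r x.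
Proof.
apply: restrict_ge0 => {}x /=; rewrite in_itv/= andbT.
exact: erlang_pdf_ge0.
Qed.


Lemma measurable_erlang_density r : measurable_fun setT (erlang_density r).
Proof. by apply/measurable_restrict => //; exact: measurable_erlang_pdf. Qed.

Lemma integral_erlang_density r (f : R -> \bar R) :
  (\int[mu]_x (f x * (erlang_density r x)%:E) =
   \int[mu]_(x in `[0%R, +oo[) (f x * (erlang_pdf r x)%:E))%E.
Proof.
rewrite [RHS]integral_mkcond; apply: eq_integral => x _.
by rewrite /erlang_density !patchE; case: ifPn; rewrite ?mule0.
Qed.

Lemma exponential_pdf1E : @exponential_pdf R 1 = erlang_density 0.
Proof.
rewrite /exponential_pdf /erlang_density; congr patch; apply/funext => x.
by rewrite /erlang_pdf expr0 divr1 mulN1r.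
Qed.

Lemma integral_erlang_density_ray r x :
  (\int[mu]_(y in `]x, +oo[) (erlang_density r y)%:E = (erlang_ccdf r.+1
    x)%:E)%E.
Proof.
rewrite /erlang_ccdf; case: ltP => x0.
  transitivity (\int[mu]_(y in `[0%R, +oo[) (erlang_pdf r y)%:E)%E; last first.
    by rewrite integral_erlang_pdf// erlang_tail0.
  rewrite integral_mkcond [RHS]integral_mkcond; apply: eq_integral => y _.
  rewrite /erlang_density !patchE !mem_setE !in_itv/= !andbT.
  case: (leP 0 y) => y0; last by case: ifP.
  by rewrite (lt_le_trans x0 y0).
rewrite -integral_erlang_pdf// -integral_itv_obnd_cbnd; last first.
  by apply/measurable_EFinP; exact: measurable_erlang_pdf.
apply: eq_integral => y; rewrite mem_setE in_itv/= andbT => xy.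
by rewrite /erlang_density patchE mem_setE in_itv/= andbT (le_trans x0 (ltW
  xy)).
Qed.

(* [measurableTypeR R], on which [lebesgue_measure] is defined, and [R] have the
   same measurable sets but carry distinct measurable structures; the real
   random variables below are recast accordingly. *)
Lemma erlang_law (nu : {finite_measure set (measurableTypeR R) -> \bar R}) r :
  (forall x, nu `]x, +oo[%classic = (erlang_ccdf r.+1 x)%:E) ->
  forall A, measurable A -> nu A = (\int[mu]_(x in A) (erlang_density r
    x)%:E)%E.
Proof.
move=> nuE A mA.
pose m := density_measure mu (erlang_density_ge0 r)
  (measurable_erlang_density r).
transitivity (m A); last by [].
apply: (@measure_unique _ R (measurableTypeR R) (@RGenOInfty.G R)
  (fun n => `](- n%:R)%R, +oo[%classic) _ _ _ _ nu m) => //.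
- exact: RGenOInfty.measurableE.
- move=> _ _ [x ->] [y ->]; exists (Num.max x y).
  apply/seteqP; split=> z /=; rewrite !in_itv/= !andbT gt_max.
    by move=> [-> ->].
  by move=> /andP[].
- by move=> n; exists (- n%:R).
- apply/seteqP; split=> // x _; exists (Num.bound `|x|) => //=.
  rewrite in_itv/= andbT ltrNl (le_lt_trans (ler_norm _))// normrN.
  exact: archi_boundP.
- move=> _ [x ->]; apply: (etrans (nuE x)).
  by apply/esym; exact: integral_erlang_density_ray.
- by move=> n; rewrite ltey_eq fin_num_measure.
Qed.

End erlang_law.

(** * Adding an independent exponential variable *)

Section erlang_convolution.
Context {R : realType}.
Notation mu := (@lebesgue_measure R).

Lemma measurable_erlang_tail r : measurable_fun setT (@erlang_tail R r).
Proof.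
apply: measurable_funM.
  by apply: continuous_measurable_fun; exact: continuous_expRN.
by apply: measurable_sum => i; apply: measurable_funM => //;
  exact: exprn_measurable.
Qed.

Lemma measurable_erlang_ccdf r : measurable_fun setT (@erlang_ccdf R r).
Proof.
apply: measurable_fun_ifT => //; last exact: measurable_erlang_tail.
exact: measurable_fun_ltr.
Qed.

Lemma erlang_ccdf_ge0 r (x : R) : 0 <= erlang_ccdf r x.
Proof. by rewrite /erlang_ccdf; case: ltP => // /erlang_tail_ge0. Qed.

Lemma continuous_exp_sum r : continuous (@exp_sum R r).
Proof.
case: r => [|r] x; last exact: is_derive_continuous (is_derive_exp_sum r x).
have -> : exp_sum 0 = cst (0 : R) by apply/funext => y;
  rewrite /exp_sum big_ord0.
exact: cvg_cst.
Qed.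

(* The Erlang tail [erlang_tail r (x - t)] times [expR (- t)] is
   [expR (- x) * exp_sum r (x - t)], a polynomial in [t]. *)
Lemma integral_exp_sum_itv r (x : R) : 0 <= x ->
  (\int[mu]_(t in `[0%R, x]) (erlang_tail r (x - t) * expR (- t))%:E =
   (expR (- x) * (exp_sum r.+1 x - 1))%:E)%E.
Proof.
rewrite le_eqVlt => /predU1P[<-|x0].
  by rewrite set_itv1 integral_set1 exp_sumS0 subrr mulr0.
pose F (t : R) := - expR (- x) * exp_sum r.+1 (x - t).
pose f (t : R) := expR (- x) * exp_sum r (x - t).
have dF (t : R) : is_derive t 1 F (f t).
  have dx : is_derive t 1 (fun t => x - t) (- 1).
    have := is_deriveB (is_derive_cst x t 1) (is_derive_id t 1).
    by rewrite sub0r.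
  have := is_deriveM (is_derive_cst (- expR (- x)) t 1)
    (is_derive1_comp (is_derive_exp_sum r _) dx).
  by move=> /is_derive_eq; apply; rewrite /f /GRing.scale /=; ring.
have cf : continuous f.
  move=> t; apply: cvgM; first exact: cvg_cst.
  apply: (@continuous_comp _ _ _ (fun t => x - t) (exp_sum r)).
    by apply: continuousB; [exact: cvg_cst|exact: cvg_id].
  exact: continuous_exp_sum.
transitivity (\int[mu]_(t in `[0%R, x]) (f t)%:E)%E.
  apply: eq_integral => t _; congr EFin.
  by rewrite /erlang_tail mulrAC -expRD /f; congr (expR _ * _); ring.
rewrite (@continuous_FTC2 _ f F)//.
- rewrite /F subrr subr0 exp_sumS0 -EFinB; congr EFin; ring.
- exact: continuous_subspaceT.
- split.
  + by move=> t _; have [] := dF t.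
  + by apply: cvg_at_right_filter; exact: is_derive_continuous (dF 0).
  + by apply: cvg_at_left_filter; exact: is_derive_continuous (dF x).
- by move=> t _; rewrite derive1E; have [_] := dF t.
Qed.

(** The integral is split at x. Beyond x the exponential variable alone exceeds the level and
    contributes e^-x, which supplies the constant term of [exp_sum] missing from the integral over
    [0, x]. *)
Lemma integral_erlang_ccdf_exp r (x : R) :
  (\int[mu]_(t in `[0%R, +oo[) (erlang_ccdf r (x - t) * erlang_pdf 0 t)%:E =
   (erlang_ccdf r.+1 x)%:E)%E.
Proof.
have [x0|x0] := ltP x 0.
  rewrite [in RHS]/erlang_ccdf x0 -(erlang_tail0 0) -integral_erlang_pdf//.
  apply: eq_integral => t; rewrite mem_setE in_itv/= andbT => t0.
  by rewrite /erlang_ccdf ifT ?mul1r// subr_lt0 (lt_le_trans x0).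
have -> : `[0%R, +oo[%classic = `[0%R, x] `|` `]x, +oo[%classic.
  by apply/seteqP; split=> t /=; rewrite !in_itv/= !andbT;
    [move=> ->; case: leP; [left|right]|move=> [/andP[]//|/ltW];
      exact: le_trans].
have mf : measurable_fun setT
    (fun t : R => (erlang_ccdf r (x - t) * erlang_pdf 0 t)%:E).
  apply/measurable_EFinP; apply: measurable_funM.
    apply: measurableT_comp; first exact: measurable_erlang_ccdf.
    exact: measurable_funB.
  exact: measurable_erlang_pdf.
rewrite ge0_integral_setU//=; last 3 first.
- exact: measurable_funTS.
- move=> t H; rewrite lee_fin mulr_ge0 ?erlang_ccdf_ge0 ?erlang_pdf_ge0//.
  move: H => [|]; rewrite !in_itv/= => /andP[]// /ltW xt _; exact: le_trans xt.
- apply/disj_setPS => t [] /=; rewrite !in_itv/= andbT => /andP[_ tx] xt.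
  by move: (le_lt_trans tx xt); rewrite ltxx.
rewrite (_ : (\int[mu]_(t in `[0%R, x]) _)%E =
    (expR (- x) * (exp_sum r.+1 x - 1))%:E); last first.
  rewrite -integral_exp_sum_itv//; apply: eq_integral => t.
  rewrite mem_setE in_itv/= => /andP[t0 tx].
  rewrite /erlang_ccdf ltNge subr_ge0 tx /=.
  by rewrite /erlang_pdf expr0 divr1 mul1r.
rewrite (_ : (\int[mu]_(t in `]x, +oo[) _)%E = (expR (- x))%:E); last first.
  transitivity (\int[mu]_(t in `]x, +oo[) (erlang_pdf 0 t)%:E)%E.
    apply: eq_integral => t; rewrite mem_setE in_itv/= andbT => xt.
    by rewrite /erlang_ccdf subr_lt0 xt mul1r.
  rewrite integral_itv_obnd_cbnd; last first.
    by apply/measurable_EFinP; exact: measurable_erlang_pdf.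
  rewrite integral_erlang_pdf//; congr EFin.
  by rewrite /erlang_tail /exp_sum big_ord1 expr0 invr1 !mulr1.
by rewrite /erlang_ccdf ltNge x0/= -EFinD; congr EFin; rewrite /erlang_tail;
  ring.
Qed.

(** Conditioning is on the exponential summand, so that of [Y] only the tail enters and the
    induction can run on tails alone. *)
Lemma exponential_add_ccdf {d} {Omega : measurableType d}
    {P : probability Omega R} (X Y : {RV P >-> R}) r :
  (forall A B, measurable A -> measurable B ->
    P ((X @^-1` A) `&` (Y @^-1` B)) = P (X @^-1` A) * P (Y @^-1` B))%E ->
  has_exponential_law 1 X ->
  (forall x, P [set w | x < Y w] = (erlang_ccdf r x)%:E) ->
  forall x, P [set w | x < X w + Y w] = (erlang_ccdf r.+1 x)%:E.
Proof.
move=> XY Xexp Yr x.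
have mX : measurable_fun setT (X : Omega -> measurableTypeR R).
  exact: (measurable_funPT X).
pose X' : {RV P >-> measurableTypeR R} :=
  @mfun_Sub _ _ Omega (measurableTypeR R) X (mem_set mX).
pose C : set (measurableTypeR R * R) := [set p | x < p.1 + p.2].
have mC : measurable C.
  have : measurable_fun setT (fun p : measurableTypeR R * R => p.1 + p.2).
    by apply: measurable_funD; [exact: measurable_fst|exact: measurable_snd].
  move=> /(_ measurableT `]x, +oo[%classic (measurable_itv _)).
  by rewrite setTI; congr measurable; apply/seteqP; split=> p /=;
    rewrite in_itv/= andbT.
rewrite (indep_pair_prob (X := X') XY C mC).
transitivity (\int[distribution P X']_t (erlang_ccdf r (x - t))%:E)%E.
  apply: eq_integral => t _; rewrite -Yr; congr (P _).
  by apply/seteqP; split=> w; rewrite /xsection/= inE/= ltrBlDl.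
rewrite (ge0_integral_density mu (erlang_density_ge0 0)
  (measurable_erlang_density 0)).
- rewrite integral_erlang_density -integral_erlang_ccdf_exp.
  by apply: eq_integral => t _; rewrite EFinM.
- move=> A mA; rewrite -exponential_pdf1E.
  exact: Xexp.
- apply/measurable_EFinP; apply: measurableT_comp.
    exact: measurable_erlang_ccdf.
  exact: measurable_funB.
- by move=> t; rewrite lee_fin erlang_ccdf_ge0.
Qed.

End erlang_convolution.

(** * Probability of a record *)

Section records.
Context {d} {Omega : measurableType d} {R : realType} {P : probability Omega R}.
Variables (T : nat -> nat -> {RV P >-> R}) (hT : iid_exp1 T).
Notation mu := (@lebesgue_measure R).

Let X (ij : nat * nat) := T ij.1 ij.2.
(** [Omega] with the sigma-algebra of the T i j, (i, j) in D: measurability from [sig D] expresses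
    dependence on these variables only. *)
Let sig (D : set (nat * nat)) := g_sigma_algebraType (cylinders X D).

Lemma measurable_sig_T (D : set (nat * nat)) i j : D (i, j) ->
  measurable_fun setT (T i j : sig D -> R).
Proof.
move=> Dij _ A mA; rewrite setTI; apply: sub_sigma_algebra.
exact: (cylinders_preimage X Dij).
Qed.

Lemma cut_timeS r j w : cut_time T r.+1 j w = T r.+1 j w + cut_time T r j w.
Proof. by rewrite /cut_time big_nat_recr//= addrC. Qed.

Lemma measurable_sig_cut_time (D : set (nat * nat)) r j :
  (forall i, (1 <= i <= r)%N -> D (i, j)) ->
  measurable_fun setT (cut_time T r j : sig D -> R).
Proof.
elim: r => [|r IH] Dr.
  rewrite (_ : cut_time T 0 j = cst 0); first exact: measurable_cst.
  by apply/funext => w; rewrite /cut_time big_geq.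
rewrite (_ : cut_time T r.+1 j = T r.+1 j \+ cut_time T r j); last first.
  by apply/funext => w; rewrite cut_timeS.
apply: measurable_funD.
  by apply: measurable_sig_T; apply: Dr; rewrite /= leqnn.
by apply: IH => i /andP[i1 ir]; apply: Dr; rewrite i1 ltnW.
Qed.

Lemma measurable_cut_time r j : measurable_fun setT (cut_time T r j).
Proof.
by apply: measurable_sum => i; exact: measurable_funPT.
Qed.

Definition cut_time_rv r j : {RV P >-> R} :=
  mfun_Sub (mem_set (measurable_cut_time r j)).

Let pos : set (nat * nat) := [set ij | (1 <= ij.1)%N /\ (1 <= ij.2)%N].

Lemma sig_indep (D1 D2 : set (nat * nat)) d1 d2 (T1 : measurableType d1)
    (T2 : measurableType d2) (f : Omega -> T1) (g : Omega -> T2) :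
  D1 `<=` pos -> D2 `<=` pos -> D1 `&` D2 = set0 ->
  measurable_fun setT (f : sig D1 -> T1) ->
  measurable_fun setT (g : sig D2 -> T2) ->
  forall A B, measurable A -> measurable B ->
  (P ((f @^-1` A) `&` (g @^-1` B)) = P (f @^-1` A) * P (g @^-1` B))%E.
Proof.
move=> D1p D2p D120 mf mg A B mA mB.
have [iT _] := hT.
apply: (mutually_independent_cylinders X iT D1p D2p D120).
  by have := mf measurableT A mA; rewrite setTI.
by have := mg measurableT B mB; rewrite setTI.
Qed.

Lemma cut_time_ccdf r j x : (1 <= j)%N ->
  P [set w | x < cut_time T r j w] = (erlang_ccdf r x)%:E.
Proof.
move=> j1; elim: r x => [|r IH] x.
  rewrite /erlang_ccdf /erlang_tail /exp_sum big_ord0 mulr0 /cut_time.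
  under eq_set => w do rewrite big_geq//.
  case: ltP => x0.
    by rewrite (_ : mkset _ = setT) ?probability_setT//; apply/seteqP; split.
  by rewrite (_ : mkset _ = set0) ?measure0//; apply/seteqP; split.
under eq_set => w do rewrite cut_timeS.
apply: (exponential_add_ccdf (T r.+1 j) (cut_time_rv r j)) => //.
  apply: (sig_indep [set (r.+1, j)] [set ij | (1 <= ij.1 <= r)%N /\ ij.2 = j]).
  - by move=> _ ->.
  - by move=> [a b] [/= /andP[a1 _] ->].
  - by apply/seteqP; split=> // -[a b] [/= [-> ->]] []; rewrite ltnn andbF.
  - exact: measurable_sig_T.
  - exact: measurable_sig_cut_time.
by have [_] := hT; exact.
Qed.

Lemma cut_time_law r j A : (1 <= j)%N -> measurable A ->
  P (cut_time T r.+1 j @^-1` A) = (\int[mu]_(x in A) (erlang_density r x)%:E)%E.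
Proof.
move=> j1 mA.
have mX : measurable_fun setT (cut_time T r.+1 j : Omega -> measurableTypeR R).
  exact: measurable_cut_time.
pose Y : {RV P >-> measurableTypeR R} :=
  @mfun_Sub _ _ Omega (measurableTypeR R) _ (mem_set mX).
rewrite -(erlang_law (distribution P Y))// => x.
rewrite -(cut_time_ccdf r.+1 j)//; congr (P _).
by apply/seteqP; split=> w /=; rewrite in_itv/= andbT.
Qed.

(** Indexed so that node j+1 is compared with [min_cut_time k j]. *)
Definition min_cut_time k j w : \bar R :=
  (\big[Order.min/+oo]_(1 <= i < j.+1) (cut_time T k i w)%:E)%E.

Lemma min_cut_timeS k j w :
  min_cut_time k j.+1 w = Order.min (min_cut_time k j w) (cut_time T k j.+1
    w)%:E.
Proof. by rewrite /min_cut_time big_nat_recr. Qed.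

Let block k j : set (nat * nat) :=
  [set ic | (1 <= ic.1 <= k)%N /\ (1 <= ic.2 <= j)%N].

(** [D] is any set containing the block, so that the induction on j shrinks the block while the
    sigma-algebra stays fixed. *)
Lemma measurable_sig_min_cut_time k j (D : set (nat * nat)) : block k j `<=` D
  ->
  measurable_fun setT (min_cut_time k j : sig D -> \bar R).
Proof.
elim: j => [|j IH] jD.
  rewrite (_ : min_cut_time k 0 = cst +oo%E); first exact: measurable_cst.
  by apply/funext => w; rewrite /min_cut_time big_geq.
rewrite (_ : min_cut_time k j.+1 = fun w =>
  Order.min (min_cut_time k j w) (cut_time T k j.+1 w)%:E); last first.
  by apply/funext => w; rewrite min_cut_timeS.
apply: measurable_mine.
  apply: IH => -[a b] [/= ak /andP[b1 bj]]; apply: jD; split => //=.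
  by rewrite b1 ltnW.
apply/measurable_EFinP; apply: measurable_sig_cut_time => i ik.
by apply: jD; split=> //=; rewrite leqnn.
Qed.

Lemma measurable_min_cut_time k j : measurable_fun setT (min_cut_time k j).
Proof.
elim: j => [|j IH].
  rewrite (_ : min_cut_time k 0 = cst +oo%E); first exact: measurable_cst.
  by apply/funext => w; rewrite /min_cut_time big_geq.
rewrite (_ : min_cut_time k j.+1 = fun w =>
  Order.min (min_cut_time k j w) (cut_time T k j.+1 w)%:E); last first.
  by apply/funext => w; rewrite min_cut_timeS.
by apply: measurable_mine => //; apply/measurable_EFinP;
  exact: measurable_cut_time.
Qed.

Definition min_cut_time_rv k j : {RV P >-> \bar R} :=
  mfun_Sub (mem_set (measurable_min_cut_time k j)).

(** Distinct nodes use distinct columns of [T], hence the power; the empty minimum +oo gives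
    exponent 0. *)
Lemma min_cut_time_ccdf k j x :
  P [set w | x%:E < min_cut_time k j w]%E = (erlang_ccdf k x ^+ j)%:E.
Proof.
elim: j => [|j IH].
  rewrite expr0 (_ : mkset _ = setT) ?probability_setT//.
  by apply/seteqP; split=> w _ //=; rewrite /min_cut_time big_geq// ltry.
transitivity (P ((min_cut_time k j @^-1` `]x%:E, +oo[%classic) `&`
                 (cut_time T k j.+1 @^-1` `]x, +oo[%classic))).
  congr (P _); apply/seteqP; split=> w /=;
    rewrite min_cut_timeS lt_min !in_itv/= !andbT ?lte_fin.
    by move=> /andP[].
  by move=> [-> ->].
rewrite (sig_indep (block k j) [set ij | (1 <= ij.1 <= k)%N /\ ij.2 = j.+1])//.
- rewrite exprSr EFinM -IH -(cut_time_ccdf k j.+1 x)//.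
  by congr (P _ * P _)%E; apply/seteqP; split=> w /=; rewrite in_itv/= andbT.
- by move=> [a b] [/= /andP[a1 _] /andP[b1 _]].
- by move=> [a b] [/= /andP[a1 _] ->].
- apply/seteqP; split=> // -[a b] [[/= _ /andP[_ bj]] [/= _ bE]].
  by move: bj; rewrite bE ltnn.
- exact: measurable_sig_min_cut_time.
- by apply: measurable_sig_cut_time => i.
- exact: emeasurable_itv.
Qed.

Lemma is_recordE k r j w :
  is_record T k r j.+1 w = ((cut_time T r j.+1 w)%:E < min_cut_time k j w)%E.
Proof. by []. Qed.

Lemma measurable_is_record k r j : measurable [set w | is_record T k r j.+1 w].
Proof.
under eq_set do rewrite is_recordE.
rewrite -[X in measurable X]setTI; apply: measurable_lte => //.
  by apply/measurable_EFinP; exact: measurable_cut_time.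
exact: measurable_min_cut_time.
Qed.

Lemma record_prob k r j :
  P [set w | is_record T k r.+1 j.+1 w] =
  (\int[mu]_(x in `[0%R, +oo[) (erlang_pdf r x * erlang_tail k x ^+ j)%:E)%E.
Proof.
have mY : measurable_fun setT (cut_time T r.+1 j.+1 : Omega -> measurableTypeR
  R).
  exact: measurable_cut_time.
pose Y : {RV P >-> measurableTypeR R} :=
  @mfun_Sub _ _ Omega (measurableTypeR R) _ (mem_set mY).
pose C : set (measurableTypeR R * \bar R) := [set p | p.1%:E < p.2]%E.
have mC : measurable C.
  rewrite -[X in measurable X]setTI; apply: measurable_lte => //.
  by apply/measurable_EFinP; exact: measurable_fst.
have YM A B : measurable A -> measurable B ->
    (P ((Y @^-1` A) `&` (min_cut_time_rv k j @^-1` B)) =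
     P (Y @^-1` A) * P (min_cut_time_rv k j @^-1` B))%E.
  move=> mA mB.
  apply: (sig_indep [set ij | (1 <= ij.1 <= r.+1)%N /\ ij.2 = j.+1] (block k
    j)) => //.
  - by move=> [a b] [/= /andP[a1 _] ->].
  - by move=> [a b] [/= /andP[a1 _] /andP[b1 _]].
  - apply/seteqP; split=> // -[a b] [[/= _ bE] [/= _ /andP[_ bj]]].
    by move: bj; rewrite bE ltnn.
  - by apply: measurable_sig_cut_time => i.
  - exact: measurable_sig_min_cut_time.
transitivity (P [set w | C (Y w, min_cut_time_rv k j w)]); first by [].
rewrite (indep_pair_prob YM C mC).
transitivity (\int[distribution P Y]_t (erlang_ccdf k t ^+ j)%:E)%E.
  apply: eq_integral => t _; rewrite -min_cut_time_ccdf; congr (P _).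
  by apply/seteqP; split=> w; rewrite /xsection/= inE.
rewrite (ge0_integral_density mu (erlang_density_ge0 r)
  (measurable_erlang_density r)).
- rewrite integral_erlang_density; apply: eq_integral => t.
  rewrite mem_setE in_itv/= andbT => t0.
  by rewrite /erlang_ccdf ltNge t0/= -EFinM mulrC.
- by move=> A mA; exact: cut_time_law.
- apply/measurable_EFinP; apply: measurable_funX.
  exact: measurable_erlang_ccdf.
- by move=> t; rewrite lee_fin exprn_ge0// erlang_ccdf_ge0.
Qed.

End records.

(* The probability that node [j.+1] is an [r.+1]-record. *)
Definition record_mean {R : realType} (k r j : nat) : R :=
  \int[lebesgue_measure]_(x in `[0, +oo[) (erlang_pdf r x * erlang_tail k x ^+
    j).

(** * Expectations as sums of record probabilities *)

Section expectations.
Context {d} {Omega : measurableType d} {R : realType} {P : probability Omega R}.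
Variables (T : nat -> nat -> {RV P >-> R}) (hT : iid_exp1 T).

Lemma prob_is_record k r j :
  P [set w | is_record T k r.+1 j.+1 w] = (record_mean k r j)%:E.
Proof.
rewrite /record_mean /Rintegral -(record_prob T hT) fineK// fin_num_measure//.
exact: measurable_is_record.
Qed.

Lemma measurable_is_recordR k r j :
  measurable_fun setT (fun w => (is_record T k r j.+1 w)%:R : R).
Proof.
rewrite (_ : (fun w => _) = \1_[set w | is_record T k r j.+1 w]).
  exact/measurable_indicP/measurable_is_record.
by apply/funext => w; rewrite indicE mem_setE.
Qed.

Lemma num_recordsE k n r w :
  num_records T k n r w = \sum_(j < n) (is_record T k r j.+1 w)%:R.
Proof. by rewrite /num_records big_add1 big_mkord. Qed.

Lemma expectation_num_records k n r :
  ('E_P[num_records T k n r.+1] = (\sum_(j < n) record_mean k r j)%:E)%E.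
Proof.
rewrite unlock.
under eq_integral => w _ do rewrite num_recordsE -sumEFin.
rewrite ge0_integral_sum//; last first.
  by move=> j; apply/measurable_EFinP; exact: measurable_is_recordR.
rewrite -sumEFin; apply: eq_bigr => j _; rewrite -prob_is_record.
rewrite -[X in P X]setIT -integral_indic//; last exact: measurable_is_record.
by apply: eq_integral => w _; rewrite indicE mem_setE.
Qed.

Lemma mean_recordsE k n r :
  mean_records T k n r.+1 = \sum_(j < n) record_mean k r j.
Proof. by rewrite /mean_records expectation_num_records. Qed.

Lemma mean_kcutE k n : mean_kcut T k n = \sum_(r < k) mean_records T k n r.+1.
Proof.
rewrite /mean_kcut unlock.
under eq_integral => w _ do
  rewrite /kcut_number big_add1 big_mkord -sumEFin.
rewrite ge0_integral_sum//; last 2 first.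
- move=> r; apply/measurable_EFinP.
  rewrite (_ : num_records T k n r.+1 =
    fun w => \sum_(j < n) (is_record T k r.+1 j.+1 w)%:R); last first.
    by apply/funext => w; exact: num_recordsE.
  by apply: measurable_sum => j; exact: measurable_is_recordR.
- by move=> r w _; rewrite lee_fin num_recordsE sumr_ge0.
rewrite (eq_bigr (fun r : 'I_k => (\sum_(j < n) record_mean k r j)%:E)).
  by rewrite sumEFin /=; apply: eq_bigr => r _; rewrite mean_recordsE.
by move=> r _; rewrite -expectation_num_records unlock.
Qed.

Lemma record_mean_last k j : record_mean k.+1 k j = j.+1%:R^-1 :> R.
Proof. by rewrite /record_mean /Rintegral integral_erlang_pdf_tailX. Qed.

End expectations.

(** * Gamma and stretched exponential integrals *)

Section gamma.
Context {R : realType}.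
Notation mu := (@lebesgue_measure R).
Implicit Types (m r : nat) (lam s x t : R).

Lemma bigcup_itv_inv_itv : \bigcup_n `[n.+1%:R^-1, n.+1%:R : R]%classic = `]0,
  +oo[%classic.
Proof.
apply/seteqP; split=> [x [n _]|x] /=; rewrite !in_itv/= ?andbT.
  by move=> /andP[+ _]; apply: lt_le_trans; rewrite invr_gt0.
move=> x0; exists (Num.bound (Num.max x x^-1)) => //=.
have max0 : 0 <= Num.max x x^-1 by rewrite le_max ltW.
have := ltW (archi_boundP max0); rewrite ge_max => /andP[xb xib].
rewrite in_itv/=; apply/andP; split; last first.
  by apply: (le_trans xb); rewrite ler_nat.
rewrite -[leRHS]invrK lef_pV2 ?posrE ?invr_gt0//.
by apply: (le_trans xib); rewrite ler_nat.
Qed.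

Lemma cvg_integral_itv_inv_itv (f : R -> R) :
  (forall x, 0 < x -> 0 <= f x) -> measurable_fun (`]0, +oo[%classic : set R) f
    ->
  (\int[mu]_(x in `[(n.+1%:R^-1)%R, n.+1%:R%R]) (f x)%:E @[n --> \oo] -->
   \int[mu]_(x in `]0%R, +oo[) (f x)%:E)%E.
Proof.
move=> f0 mf.
have sub n : `[n.+1%:R^-1, n.+1%:R : R]%classic `<=` `]0, +oo[%classic.
  by move=> x nx; rewrite -bigcup_itv_inv_itv; exists n.
rewrite -[X in _ --> integral _ X _]bigcup_itv_inv_itv.
apply: ge0_nondecreasing_set_cvg_integral.
- move=> a b ab; apply/subsetPset; apply: subset_itv; rewrite bnd_simp.
    by rewrite lef_pV2 ?posrE// ler_nat.
  by rewrite ler_nat.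
- by move=> i.
- by move=> i; apply/measurable_EFinP; exact: measurable_funS (sub i) mf.
- move=> i x /sub /=; rewrite in_itv/= andbT => x0; rewrite lee_fin; exact: f0.
Qed.

Definition gamma_fun s t : R := t `^ (s - 1) * expR (- t).

Lemma is_derive_gamma_fun s t : 0 < t ->
  is_derive t 1 (gamma_fun s) ((s - 1) * t `^ (s - 1 - 1) * expR (- t)
                              - t `^ (s - 1) * expR (- t)).
Proof.
move=> t0.
have := is_deriveM (is_derive1_powR (s - 1) t0) (is_derive_expRN t).
by move=> /is_derive_eq; apply; rewrite /GRing.scale /=; ring.
Qed.

(* The parameters are those of the paper shifted by one: [m.+1] is the number of
   cuts and [r.+1] the order of the record. *)
Definition stretched_exp m r lam x : R := x ^+ r * expR (- (lam * x ^+ m.+1)).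

Lemma continuous_stretched_exp m r lam : continuous (stretched_exp m r lam).
Proof.
move=> x; apply: is_derive_continuous.
exact: is_deriveM (is_derive_exprn r x) (is_derive1_comp (is_derive_expR _)
  (is_deriveN (is_deriveM (is_derive_cst lam x 1) (is_derive_exprn m.+1 x)))).
Qed.

Lemma measurable_stretched_exp m r lam (D : set R) :
  measurable_fun D (stretched_exp m r lam).
Proof.
apply: measurable_funTS; apply: continuous_measurable_fun.
exact: continuous_stretched_exp.
Qed.

Lemma stretched_exp_ge0 m r lam x : 0 <= x -> 0 <= stretched_exp m r lam x.
Proof. by move=> x0; rewrite mulr_ge0 ?expR_ge0 ?exprn_ge0. Qed.

(** With y = lam x^(m+1) and s = (r+1)/(m+1), the left side is y^s e^-y (y'/y), where y^s = lam^s
    x^(r+1) and y'/y = (m+1)/x. *)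
Lemma gamma_fun_subst m r lam x : 0 < lam -> 0 < x ->
  gamma_fun (r.+1%:R / m.+1%:R) (lam * x ^+ m.+1) * (lam * (m.+1%:R * x ^+ m)) =
  lam `^ (r.+1%:R / m.+1%:R) * m.+1%:R * stretched_exp m r lam x.
Proof.
move=> lam0 x0; set s := _ / _; set y := lam * _.
have xm0 : 0 < x ^+ m.+1 by rewrite exprn_gt0.
have y0 : 0 < y by rewrite mulr_gt0.
have ys : y `^ s = lam `^ s * x ^+ r.+1.
  rewrite powRM ?ltW// -powR_mulrn ?ltW// -powRrM /s mulrCA divff ?mulr1
    ?pnatr_eq0//.
  by rewrite powR_mulrn// ltW.
rewrite /gamma_fun powRB ?powRr1 ?ltW// ?(gt_eqF y0) ?implybT//.
rewrite ys /stretched_exp -/y /y !exprS.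
have lamN0 : lam != 0 by rewrite gt_eqF.
have xN0 : x != 0 by rewrite gt_eqF.
have xmN0 : x ^+ m != 0 by rewrite expf_neq0.
by field; rewrite lamN0 xN0 xmN0.
Qed.

(* The library's rule for increasing substitutions on a half-line requires the
   derivative to converge at [+oo], so the half-line is exhausted by compact
   intervals, which also avoids the singularity of [gamma_fun] at [0]. *)
Lemma gamma_subst m r lam : 0 < lam ->
  (\int[mu]_(t in `]0%R, +oo[) (gamma_fun (r.+1%:R / m.+1%:R) t)%:E =
   (lam `^ (r.+1%:R / m.+1%:R) * m.+1%:R)%:E *
   \int[mu]_(x in `[0%R, +oo[) (stretched_exp m r lam x)%:E)%E.
Proof.
move=> lam0; set s := _ / _.
pose F (x : R) := lam * x ^+ m.+1.
have F0 x : 0 < x -> 0 < F x by move=> x0; rewrite mulr_gt0 ?exprn_gt0.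
have dF x : is_derive x 1 F (lam * (m.+1%:R * x ^+ m)).
  have := is_deriveM (is_derive_cst lam x 1) (is_derive_exprn m.+1 x).
  by move=> /is_derive_eq; apply; rewrite scaler0 addr0.
have F'E : derive1 F = fun x => lam * (m.+1%:R * x ^+ m).
  by apply/funext => x; rewrite derive1E; have [_] := dF x.
have F_homo x y : 0 <= x -> x < y -> F x < F y.
  by move=> x0 xy; rewrite ltr_pM2l// ltrXn2r.
have F_mono x y : 0 <= x -> x <= y -> F x <= F y.
  by move=> x0; rewrite le_eqVlt => /predU1P[->//|/(F_homo _ _ x0)/ltW].
have cF' : continuous (derive1 F).
  move=> x; rewrite F'E; apply: cvgM; first exact: cvg_cst.
  by apply: cvgM; [exact: cvg_cst|exact: exprn_continuous].
have a0 n : (0 : R) < n.+1%:R^-1 by rewrite invr_gt0.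
have ab n : n.+1%:R^-1 <= n.+1%:R :> R.
  by apply: (@le_trans _ _ 1); rewrite ?invf_le1 ?ler1n.
have step n :
  (\int[mu]_(t in `[F (n.+1%:R^-1)%R, F n.+1%:R%R]) (gamma_fun s t)%:E =
   \int[mu]_(x in `[(n.+1%:R^-1)%R, n.+1%:R%R])
     (lam `^ s * m.+1%:R * stretched_exp m r lam x)%:E)%E.
  rewrite integration_by_substitution_increasing.
  - apply: eq_integral => x; rewrite mem_setE in_itv/= => /andP[nx _].
    by rewrite -gamma_fun_subst// ?(lt_le_trans (a0 n))// fctE F'E.
  - exact: ab.
  - move=> x y; rewrite !in_itv/= => /andP[nx _] _; apply: F_homo.
    exact: le_trans (ltW (a0 n)) nx.
  - by move=> x _; exact: cF'.
  - by apply: cvgP; apply: cvg_at_right_filter; exact: cF'.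
  - by apply: cvgP; apply: cvg_at_left_filter; exact: cF'.
  - split.
    + by move=> x _; have [] := dF x.
    + by apply: cvg_at_right_filter; exact: is_derive_continuous (dF _).
    + by apply: cvg_at_left_filter; exact: is_derive_continuous (dF _).
  - apply: derivable_within_continuous => t; rewrite in_itv/= => /andP[nt _].
    by have [] := is_derive_gamma_fun s t (lt_le_trans (F0 _ (a0 n)) nt).
have mG : measurable_fun (`]0, +oo[%classic : set R) (gamma_fun s).
  apply: open_continuous_measurable_fun => // t.
  rewrite mem_setE in_itv/= andbT => t0.
  exact: is_derive_continuous (is_derive_gamma_fun s t t0).
have UF : \bigcup_n `[F n.+1%:R^-1, F n.+1%:R]%classic = `]0, +oo[%classic.
  apply/seteqP; split=> [x [n _]|t] /=; rewrite !in_itv/= ?andbT.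
    by move=> /andP[+ _]; apply: lt_le_trans; exact: F0.
  move=> t0; pose x := (t / lam) `^ m.+1%:R^-1.
  have tE : t = F x.
    rewrite /F /x -powR_mulrn ?powR_ge0// -powRrM mulVf ?pnatr_eq0//.
    rewrite powRr1 ?divr_ge0 ?ltW// mulrC divfK// gt_eqF//.
  have : `]0, +oo[%classic x by rewrite /= in_itv/= andbT powR_gt0// divr_gt0.
  rewrite -bigcup_itv_inv_itv => -[n _ /=]; rewrite in_itv/= => /andP[nx xn].
  exists n => //=; rewrite in_itv/= tE; apply/andP.
  by split; apply: F_mono => //; exact: le_trans (ltW (a0 n)) nx.
have L : (\int[mu]_(t in `[F (n.+1%:R^-1)%R, F n.+1%:R%R]) (gamma_fun s t)%:E
    @[n --> \oo] --> \int[mu]_(t in `]0%R, +oo[) (gamma_fun s t)%:E)%E.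
  rewrite -[X in _ --> integral _ X _]UF.
  have sub n : `[F n.+1%:R^-1, F n.+1%:R]%classic `<=` `]0, +oo[%classic.
    by move=> x nx; rewrite -UF; exists n.
  apply: ge0_nondecreasing_set_cvg_integral.
  - move=> a b ab'; apply/subsetPset; apply: subset_itv; rewrite bnd_simp.
      by apply: F_mono => //; rewrite lef_pV2 ?posrE// ler_nat.
    by apply: F_mono => //; rewrite ler_nat.
  - by move=> i.
  - by move=> i; apply/measurable_EFinP; exact: measurable_funS (sub i) mG.
  - by move=> i x _; rewrite lee_fin mulr_ge0 ?expR_ge0 ?powR_ge0.
pose f x := lam `^ s * m.+1%:R * stretched_exp m r lam x.
have f0 x : 0 < x -> 0 <= f x.
  move=> /ltW x0; apply: mulr_ge0; last exact: stretched_exp_ge0.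
  by rewrite mulr_ge0 ?powR_ge0.
have mf (D : set R) : measurable_fun D f.
  by apply: measurable_funM => //; exact: measurable_stretched_exp.
have := cvg_integral_itv_inv_itv f f0 (mf _).
rewrite (_ : (fun n => _) = (fun n => \int[mu]_(t in `[F (n.+1%:R^-1)%R, F
  n.+1%:R%R])
  (gamma_fun s t)%:E)%E); last by apply/funext => n; rewrite step.
move=> L'.
rewrite (cvg_unique _ L L')// integral_itv_obnd_cbnd; last first.
  by apply/measurable_EFinP; exact: mf.
under eq_integral do rewrite EFinM.
rewrite ge0_integralZl//.
- by apply/measurable_EFinP; exact: measurable_stretched_exp.
- by move=> x /=; rewrite in_itv/= andbT => x0;
    rewrite lee_fin stretched_exp_ge0.
- by rewrite lee_fin mulr_ge0 ?powR_ge0.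
Qed.

End gamma.

(** * Finiteness, positivity and special values of the Gamma function *)

Section gamma_values.
Context {R : realType}.
Notation mu := (@lebesgue_measure R).
Implicit Types (m r : nat) (lam s x t : R).

(** The factor e comes from - x^(m+1) <= 1 - x: for x <= 1 the right side is nonnegative, and for x
    >= 1 one has x <= x^(m+1). *)
Lemma stretched_exp_le_erlang m r x : 0 <= x ->
  stretched_exp m r 1 x <= expR 1 * r`!%:R * erlang_pdf r x.
Proof.
move=> x0; rewrite /stretched_exp /erlang_pdf mul1r.
have r0 : (r`!%:R : R) != 0 by rewrite pnatr_eq0 -lt0n fact_gt0.
rewrite [leRHS](_ : _ = x ^+ r * (expR 1 * expR (- x))); last by field.
rewrite ler_wpM2l ?exprn_ge0// -expRD ler_expR.
have [x1|/ltW x1] := leP x 1.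
  by rewrite (@le_trans _ _ 0) ?oppr_le0 ?exprn_ge0// subr_ge0.
rewrite (@le_trans _ _ (- x)) ?lerN2 ?lerDr//.
by rewrite exprS ler_peMr// exprn_ege1.
Qed.

(** [Gamma] is a real-valued integral, in which an infinite value would silently become 0; the
    substitution with lam = 1 gives an integrand with an integrable Erlang majorant. *)
Lemma gamma_integral_lty m r :
  (\int[mu]_(t in `]0%R, +oo[) (gamma_fun (r.+1%:R / m.+1%:R) t)%:E < +oo)%E.
Proof.
rewrite (gamma_subst m r _ ltr01) powR1 mul1r lte_mul_pinfty//.
apply: (@le_lt_trans _ _ (\int[mu]_(x in `[0%R, +oo[)
    ((expR 1 * r`!%:R)%:E * (erlang_pdf r x)%:E))%E).
  apply: ge0_le_integral => //.
  - by move=> x /=; rewrite in_itv/= andbT => x0;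
      rewrite lee_fin stretched_exp_ge0.
  - by apply/measurable_EFinP; exact: measurable_stretched_exp.
  - apply/measurable_EFinP; apply: measurable_funM => //.
    exact: measurable_erlang_pdf.
  - move=> x /=; rewrite in_itv/= andbT => x0.
    by rewrite -EFinM lee_fin stretched_exp_le_erlang.
rewrite ge0_integralZl//.
- by rewrite integral_erlang_pdf// lte_mul_pinfty// ?lee_fin ?mulr_ge0
    ?expR_ge0 ?ltry.
- by apply/measurable_EFinP; exact: measurable_erlang_pdf.
- by move=> x /=; rewrite in_itv/= andbT => x0; rewrite lee_fin erlang_pdf_ge0.
Qed.

Lemma gamma_integralE m r :
  (\int[mu]_(t in `]0%R, +oo[) (gamma_fun (r.+1%:R / m.+1%:R) t)%:E =
   (Gamma (r.+1%:R / m.+1%:R))%:E)%E.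
Proof.
rewrite /Gamma /Rintegral fineK// ge0_fin_numE ?gamma_integral_lty//.
by apply: integral_ge0 => t _; rewrite lee_fin mulr_ge0 ?powR_ge0 ?expR_ge0.
Qed.

Lemma integral_stretched_exp m r lam : 0 < lam ->
  (\int[mu]_(x in `[0%R, +oo[) (stretched_exp m r lam x)%:E =
   (Gamma (r.+1%:R / m.+1%:R) / m.+1%:R * lam `^ (- (r.+1%:R / m.+1%:R)))%:E)%E.
Proof.
move=> lam0; have := gamma_subst m r lam lam0; rewrite gamma_integralE.
have c0 : 0 < lam `^ (r.+1%:R / m.+1%:R) * m.+1%:R by rewrite mulr_gt0
  ?powR_gt0.
have : (0 <= \int[mu]_(x in `[0%R, +oo[) (stretched_exp m r lam x)%:E)%E.
  apply: integral_ge0 => x /=; rewrite in_itv/= andbT => x0.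
  by rewrite lee_fin stretched_exp_ge0.
(* The integral is known only through its product with a positive constant: finiteness of that
   product excludes +oo, and nonnegativity excludes -oo. *)
case: (\int[mu]_(x in _) _)%E => [w _ [] ->| |] //.
- congr EFin; rewrite powRN; set a := lam `^ _; set b := m.+1%:R.
  have a0 : a != 0 by rewrite gt_eqF// powR_gt0.
  have b0 : b != 0 by rewrite pnatr_eq0.
  by clearbody a b; field; rewrite a0 b0.
- by rewrite gt0_muley ?lte_fin.
Qed.

(** For m = 0 and lam = 1 the stretched exponential is r! times an Erlang density, which has mass
    1. *)
Lemma Gamma_fact r : Gamma r.+1%:R = r`!%:R :> R.
Proof.
have := integral_stretched_exp 0 r 1 ltr01; rewrite !divr1 powR1 mulr1.
under eq_integral => x _.
  rewrite (_ : stretched_exp 0 r 1 x = r`!%:R * erlang_pdf r x); last first.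
    have r0 : (r`!%:R : R) != 0 by rewrite pnatr_eq0 -lt0n fact_gt0.
    by rewrite /stretched_exp /erlang_pdf mul1r expr1; field.
  rewrite EFinM; over.
rewrite ge0_integralZl//.
- by rewrite integral_erlang_pdf// erlang_tail0 mule1 => -[].
- by apply/measurable_EFinP; exact: measurable_erlang_pdf.
- by move=> x /=; rewrite in_itv/= andbT => x0; rewrite lee_fin erlang_pdf_ge0.
Qed.

(** For m = 1, r = 0 and lam = 1 the stretched exponential is the Gaussian integrand. *)
Lemma Gamma_half : Gamma 2^-1 = Num.sqrt pi :> R.
Proof.
have := integral_stretched_exp 1 0 1 ltr01; rewrite powR1 mulr1 mul1r.
rewrite (_ : (\int[mu]_(x in _) _)%E = (Num.sqrt pi / 2)%:E); last first.
  rewrite -integral0y_gauss; apply: eq_integral => x _.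
  by rewrite /stretched_exp /gauss_fun expr0 !mul1r.
by move=> [] /(divIf _) ->.
Qed.

Lemma Gamma_gt0 m r : 0 < Gamma (r.+1%:R / m.+1%:R) :> R.
Proof.
suff : 0 < Gamma (r.+1%:R / m.+1%:R) / m.+1%:R :> R by rewrite pmulr_lgt0.
rewrite -lte_fin.
have := integral_stretched_exp m r 1 ltr01; rewrite powR1 mulr1 => <-.
(* On [1/2, 1] the integrand is at least 2^-r e^-1, a positive constant. *)
apply: (@lt_le_trans _ _ (\int[mu]_(x in `[2^-1%R, 1%R]) ((2^-1) ^+ r * expR (-
  1))%:E)%E).
  rewrite integral_cst//= lebesgue_measure_itv/= lte_fin invf_lt1 ?ltr1n//.
  rewrite -EFinB -EFinM lte_fin !mulr_gt0 ?exprn_gt0 ?expR_gt0 ?subr_gt0//.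
  by rewrite invf_lt1 ?ltr1n.
apply: (@le_trans _ _ (\int[mu]_(x in `[2^-1%R, 1%R]) (stretched_exp m r 1
  x)%:E)%E).
  apply: ge0_le_integral => //.
  - by apply/measurable_EFinP; exact: measurable_stretched_exp.
  - move=> x /=; rewrite in_itv/= => /andP[x0 x1].
    rewrite lee_fin /stretched_exp mul1r ler_pM ?exprn_ge0 ?expR_ge0//.
      by rewrite lerXn2r ?nnegrE// (le_trans _ x0).
    by rewrite ler_expR lerN2 exprn_ile1// (le_trans _ x0).
apply: ge0_subset_integral => //.
- by apply/measurable_EFinP; exact: measurable_stretched_exp.
- by move=> x /=; rewrite in_itv/= andbT => x0;
    rewrite lee_fin stretched_exp_ge0.
- move=> x /=; rewrite !in_itv/= andbT => /andP[x0 _].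
  by rewrite (le_trans _ x0).
Qed.

End gamma_values.

(** * Limits *)

Section record_mean_bounds.
Context {R : realType}.
Notation mu := (@lebesgue_measure R).
Implicit Types (m r j : nat) (x delta : R).

Lemma erlang_tail_nonincreasing m x y : 0 <= x -> x <= y ->
  erlang_tail m.+1 y <= erlang_tail m.+1 x.
Proof.
move=> x0 xy; rewrite -lerN2.
apply: (is_derive_ge0_le (fun y => - erlang_tail m.+1 y) (erlang_pdf m)) => //.
  move=> z _; rewrite -[erlang_pdf _ _]opprK.
  exact: is_deriveN (is_derive_erlang_tail m z).
by move=> z xz; rewrite erlang_pdf_ge0// (le_trans x0).
Qed.

Lemma measurable_record_integrand m r j (D : set R) :
  measurable_fun D (fun x : R => erlang_pdf r x * erlang_tail m x ^+ j).
Proof.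
apply: measurable_funM; first exact: measurable_erlang_pdf.
by apply: measurable_funX; apply: measurable_funTS;
  exact: measurable_erlang_tail.
Qed.

Lemma record_integrand_ge0 m r j x : 0 <= x ->
  0 <= erlang_pdf r x * erlang_tail m x ^+ j.
Proof. by move=> x0; rewrite mulr_ge0 ?erlang_pdf_ge0 ?exprn_ge0
  ?erlang_tail_ge0. Qed.

Lemma record_meanE m r j :
  (\int[mu]_(x in `[0%R, +oo[) (erlang_pdf r x * erlang_tail m.+1 x ^+ j)%:E =
   (record_mean m.+1 r j)%:E)%E.
Proof.
rewrite /record_mean /Rintegral fineK// ge0_fin_numE; last first.
  apply: integral_ge0 => x /=; rewrite in_itv/= andbT => x0.
  by rewrite lee_fin record_integrand_ge0.
apply: (@le_lt_trans _ _ (\int[mu]_(x in `[0%R, +oo[) (erlang_pdf r x)%:E)%E).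
  apply: ge0_le_integral => //.
  - by move=> x /=; rewrite in_itv/= andbT => x0;
      rewrite lee_fin record_integrand_ge0.
  - by apply/measurable_EFinP; exact: measurable_record_integrand.
  - by apply/measurable_EFinP; exact: measurable_erlang_pdf.
  - move=> x /=; rewrite in_itv/= andbT => x0; rewrite lee_fin.
    by rewrite ler_piMr ?erlang_pdf_ge0 ?exprn_ile1 ?erlang_tail_ge0
      ?erlang_tail_le1.
by rewrite integral_erlang_pdf// ltry.
Qed.

(* The integral of [stretched_exp m r lam] over [[0, +oo[]. *)
Definition stretched_mean m r (lam : R) : R :=
  Gamma (r.+1%:R / m.+1%:R) / m.+1%:R * lam `^ (- (r.+1%:R / m.+1%:R)).

(* Uses [1 - x <= expR (- x)] to trade the exponential factor of the density for
   an integral of the next order. *)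
Lemma record_mean_ge m r j : (0 < j)%N ->
  stretched_mean m r (j%:R / (m.+1)`!%:R) - stretched_mean m r.+1 (j%:R /
    (m.+1)`!%:R)
  <= r`!%:R * record_mean m.+1 r j.
Proof.
move=> j0; set lam := _ / _.
have lam0 : 0 < lam by rewrite divr_gt0 ?ltr0n ?fact_gt0.
rewrite lerBlDr -lee_fin EFinD (EFinM r`!%:R).
rewrite /stretched_mean -!integral_stretched_exp// -record_meanE.
rewrite -ge0_integralZl//; last 2 first.
- by apply/measurable_EFinP; exact: measurable_record_integrand.
- by move=> x /=; rewrite in_itv/= andbT => x0;
    rewrite lee_fin record_integrand_ge0.
rewrite -ge0_integralD//; last 4 first.
- move=> x /=; rewrite in_itv/= andbT => x0.
  by rewrite -EFinM lee_fin mulr_ge0 ?record_integrand_ge0.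
- by apply/measurable_EFinP; apply: measurable_funM => //;
    exact: measurable_record_integrand.
- by move=> x /=; rewrite in_itv/= andbT => x0;
    rewrite lee_fin stretched_exp_ge0.
- by apply/measurable_EFinP; exact: measurable_stretched_exp.
apply: ge0_le_integral => //.
- by move=> x /=; rewrite in_itv/= andbT => x0;
    rewrite lee_fin stretched_exp_ge0.
- by apply/measurable_EFinP; exact: measurable_stretched_exp.
- apply/measurable_EFinP; apply: measurable_funD;
    last exact: measurable_stretched_exp.
  by apply: measurable_funM => //; exact: measurable_record_integrand.
move=> x /=; rewrite in_itv/= andbT => x0; rewrite -EFinM -EFinD lee_fin.
set E := expR (- (lam * x ^+ m.+1)).
have ET : E <= erlang_tail m.+1 x ^+ j.
  rewrite /E (_ : - _ = - (x ^+ m.+1 / (m.+1)`!%:R) * j%:R); last first.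
    by rewrite /lam; ring.
  by rewrite expRM_natr lerXn2r ?nnegrE ?expR_ge0 ?erlang_tail_ge0//
    expR_le_erlang_tail.
have r0 : (r`!%:R : R) != 0 by rewrite pnatr_eq0 -lt0n fact_gt0.
have -> : r`!%:R * (erlang_pdf r x * erlang_tail m.+1 x ^+ j) =
    x ^+ r * (expR (- x) * erlang_tail m.+1 x ^+ j).
  by rewrite /erlang_pdf; field.
rewrite /stretched_exp -/E exprSr -mulrA -mulrDr ler_wpM2l ?exprn_ge0//.
have xE : 0 <= expR (- x) + x - 1 by have := expR_ge1Dx (- x); lra.
have E0 : 0 <= E by exact: expR_ge0.
(* Writing T for the tail, E (1 - x) <= E e^-x <= e^-x T^j. *)
have := ler_wpM2l (expR_ge0 (- x)) ET; have := mulr_ge0 E0 xE; lra.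
Qed.

(* [delta] separates the neighbourhood of [0], where the tail is at most
   [expR (- expR (- delta) * x ^+ m.+1 / (m.+1)`!)], from the rest of the
   half-line, whose contribution is exponentially small in [j]. *)
Lemma record_mean_le m r j delta : (0 < j)%N -> 0 <= delta ->
  r`!%:R * record_mean m.+1 r j <=
  stretched_mean m r (expR (- delta) * (j%:R / (m.+1)`!%:R))
  + r`!%:R * erlang_tail m.+1 delta ^+ j.
Proof.
move=> j0 d0; set lam := expR _ * _.
have lam0 : 0 < lam by rewrite mulr_gt0 ?expR_gt0 ?divr_gt0 ?ltr0n ?fact_gt0.
have q0 : 0 <= r`!%:R * erlang_tail m.+1 delta ^+ j.
  by rewrite mulr_ge0 ?exprn_ge0 ?erlang_tail_ge0.
rewrite -lee_fin EFinD (EFinM r`!%:R (record_mean _ _ _)).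
(* The density has mass 1, so the error term becomes an integral and the bound can be proved
   pointwise. *)
have -> : (r`!%:R * erlang_tail m.+1 delta ^+ j)%:E =
    ((r`!%:R * erlang_tail m.+1 delta ^+ j)%:E *
     \int[mu]_(x in `[0%R, +oo[) (erlang_pdf r x)%:E)%E.
  by rewrite integral_erlang_pdf// erlang_tail0 mule1.
rewrite /stretched_mean -integral_stretched_exp// -record_meanE.
rewrite -ge0_integralZl//; last 2 first.
- by apply/measurable_EFinP; exact: measurable_record_integrand.
- by move=> x /=; rewrite in_itv/= andbT => x0;
    rewrite lee_fin record_integrand_ge0.
rewrite -ge0_integralZl//; last 2 first.
- by apply/measurable_EFinP; exact: measurable_erlang_pdf.
- by move=> x /=; rewrite in_itv/= andbT => x0; rewrite lee_fin erlang_pdf_ge0.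
rewrite -ge0_integralD//; last 4 first.
- by move=> x /=; rewrite in_itv/= andbT => x0;
    rewrite lee_fin stretched_exp_ge0.
- by apply/measurable_EFinP; exact: measurable_stretched_exp.
- move=> x /=; rewrite in_itv/= andbT => x0.
  by rewrite -EFinM lee_fin mulr_ge0 ?erlang_pdf_ge0.
- by apply/measurable_EFinP; apply: measurable_funM => //;
    exact: measurable_erlang_pdf.
apply: ge0_le_integral => //.
- move=> x /=; rewrite in_itv/= andbT => x0.
  by rewrite -EFinM lee_fin mulr_ge0 ?record_integrand_ge0.
- by apply/measurable_EFinP; apply: measurable_funM => //;
    exact: measurable_record_integrand.
- apply/measurable_EFinP; apply: measurable_funD;
    first exact: measurable_stretched_exp.
  by apply: measurable_funM => //; exact: measurable_erlang_pdf.
move=> x /=; rewrite in_itv/= andbT => x0; rewrite -!EFinM -EFinD lee_fin.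
(* Beyond delta the error term alone dominates, the tail being nonincreasing; up to delta the
   stretched exponential does. *)
have [xd|/ltW dx] := leP x delta; last first.
  rewrite ler_wpDl ?stretched_exp_ge0// -[leRHS]mulrA ler_wpM2l// mulrC.
  rewrite ler_wpM2r ?erlang_pdf_ge0//.
  by rewrite lerXn2r ?nnegrE ?erlang_tail_ge0// erlang_tail_nonincreasing.
rewrite ler_wpDr//; first by rewrite mulr_ge0 ?erlang_pdf_ge0.
have r0 : (r`!%:R : R) != 0 by rewrite pnatr_eq0 -lt0n fact_gt0.
have -> : r`!%:R * (erlang_pdf r x * erlang_tail m.+1 x ^+ j) =
    x ^+ r * (expR (- x) * erlang_tail m.+1 x ^+ j).
  by rewrite /erlang_pdf; field.
rewrite /stretched_exp ler_wpM2l ?exprn_ge0//.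
rewrite (@le_trans _ _ (erlang_tail m.+1 x ^+ j))//.
  by rewrite ler_piMl ?exprn_ge0 ?erlang_tail_ge0// -expR0 ler_expR oppr_le0.
rewrite (_ : - _ = - (expR (- delta) * (x ^+ m.+1 / (m.+1)`!%:R)) * j%:R);
  last first.
  by rewrite /lam; ring.
rewrite expRM_natr lerXn2r ?nnegrE ?expR_ge0 ?erlang_tail_ge0//.
apply: (le_trans (erlang_tail_le_expR m.+1 x x0)); rewrite ler_expR lerN2.
by rewrite ler_wpM2r ?mulr_ge0 ?exprn_ge0 ?invr_ge0// ler_expR lerN2.
Qed.

End record_mean_bounds.

(** * Limit of the rescaled record probabilities *)

Section record_mean_limit.
Context {R : realType}.
Implicit Types (m r n : nat) (p : R).

Lemma cvg_powRN p : 0 < p -> (n%:R : R) `^ (- p) @[n --> \oo] --> (0 : R).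
Proof.
move=> p0; apply/cvgrPdist_le => e e0; near=> n.
have n0 : (0 : R) < n%:R by rewrite ltr0n; near: n; exact: nbhs_infty_gt.
rewrite sub0r normrN ger0_norm ?powR_ge0// powRN -[leRHS]invrK.
rewrite lef_pV2 ?posrE ?powR_gt0 ?invr_gt0//.
have -> : e^-1 = (e^-1 `^ p^-1) `^ p.
  by rewrite -powRrM mulVf ?gt_eqF// powRr1// invr_ge0 ltW.
rewrite ge0_ler_powR ?nnegrE ?powR_ge0 ?ltW//.
near: n; exact: nbhs_infty_gtr.
Unshelve. all: by end_near. Qed.

(** The coefficient of n^(-(r+1)/(m+1)) in [stretched_mean m r] at lam = n/(m+1)!. *)
Definition record_const m r : R :=
  Gamma (r.+1%:R / m.+1%:R) / m.+1%:R * (m.+1)`!%:R `^ (r.+1%:R / m.+1%:R).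

Lemma record_const_gt0 m r : 0 < record_const m r.
Proof. by rewrite mulr_gt0 ?powR_gt0 ?ltr0n ?fact_gt0// divr_gt0 ?Gamma_gt0.
  Qed.

Lemma stretched_meanE m r n (c : R) : 0 < c -> (0 < n)%N ->
  stretched_mean m r (c * (n%:R / (m.+1)`!%:R)) =
  record_const m r * c `^ (- (r.+1%:R / m.+1%:R)) * n%:R `^ (- (r.+1%:R /
    m.+1%:R)).
Proof.
move=> c0 n0; rewrite /stretched_mean /record_const; set s := _ / _.
rewrite powRM ?(ltW c0)// powRM//.
have -> : (m.+1)`!%:R^-1 `^ (- s) = (m.+1)`!%:R `^ s :> R.
  by rewrite -powR_inv1// -powRrM mulrNN mul1r.
by ring.
Qed.

Lemma stretched_mean1E m r n : (0 < n)%N ->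
  stretched_mean m r (n%:R / (m.+1)`!%:R) =
  record_const m r * n%:R `^ (- (r.+1%:R / m.+1%:R)).
Proof.
by move=> n0; have := stretched_meanE m r n 1 ltr01 n0;
  rewrite mul1r powR1 mulr1.
Qed.

(** An explicit rate for n e^(-Dn) -> 0, from the Markov bound of order 2 at y = Dn: e^-y (1 + y) <=
    2/y. *)
Lemma expRN_mul_le n (D : R) : 0 < D -> (0 < n)%N ->
  expR (- D) ^+ n * n%:R <= 2 / D ^+ 2 / n%:R.
Proof.
move=> D0 n0; have nR : (0 : R) < n%:R by rewrite ltr0n.
have Dn : 0 < D * n%:R by rewrite mulr_gt0.
have := erlang_tail_le_div 2 (D * n%:R) Dn.
rewrite /erlang_tail /exp_sum big_ord_recl big_ord1 /= expr0 expr1 invr1 !mul1r.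
rewrite mulr1 -mulNr expRM_natr mulrDr mulr1 => h.
have {}h : expR (- D) ^+ n * (D * n%:R) <= 2 / (D * n%:R).
  by apply: le_trans h; rewrite lerDr exprn_ge0 ?expR_ge0.
rewrite -(ler_pM2r D0) -[leLHS]mulrA (mulrC n%:R) (le_trans h)//.
by rewrite le_eqVlt; apply/orP; left; apply/eqP; field; rewrite !gt_eqF.
Qed.

Lemma record_mean_cvg m r : (r <= m)%N ->
  record_mean m.+1 r n * n%:R `^ (r.+1%:R / m.+1%:R) @[n --> \oo] -->
  record_const m r / r`!%:R.
Proof.
move=> rm; set s := _ / _; set B := record_const m r.
have s0 : 0 < s by rewrite divr_gt0.
have s1 : s <= 1 by rewrite ler_pdivrMr ?mul1r ?ler_nat.
have B0 : 0 < B by exact: record_const_gt0.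
have f0 : (0 : R) < r`!%:R by rewrite ltr0n fact_gt0.
apply/cvgrPdist_le => e e0.
pose C := record_const m r.+1.
have C0 : 0 < C by exact: record_const_gt0.
(* [delta] is such that [B * expR (delta * s) = B + r`! * e / 2]. *)
pose delta := ln (1 + r`!%:R * e / (2 * B)) / s.
have eB : 0 < r`!%:R * e / (2 * B) by apply: divr_gt0; apply: mulr_gt0.
have delta0 : 0 < delta by rewrite divr_gt0// ln_gt0// ltrDl.
have deltaE : expR (- delta) `^ (- s) = 1 + r`!%:R * e / (2 * B).
  rewrite -expRM mulrNN /delta divfK ?gt_eqF// lnK// posrE.
  by rewrite addr_gt0.
(* By [erlang_tail_le_expR], the tail at delta is at most e^-D. *)
pose D := expR (- delta) * (delta ^+ m.+1 / (m.+1)`!%:R).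
have D0 : 0 < D.
  by rewrite mulr_gt0 ?expR_gt0// divr_gt0 ?exprn_gt0 ?ltr0n ?fact_gt0.
near=> n.
have n0 : (0 < n)%N by near: n; exact: nbhs_infty_gt.
have nR : (0 : R) < n%:R by rewrite ltr0n.
have ns : n%:R `^ (- s) * n%:R `^ s = 1 :> R.
  by rewrite powRN mulVf// gt_eqF// powR_gt0.
rewrite ler_distlC; apply/andP; split.
  (* Lower side: after multiplication by n^s the subtracted integral is C n^(-1/(m+1)), which tends
     to 0. *)
  have := @record_mean_ge R m r n n0.
  rewrite !stretched_mean1E// -/B -/C -/s.
  move=> /(ler_wpM2r (powR_ge0 n%:R s)).
  rewrite mulrBl -mulrA ns mulr1 => h.
  rewrite -(ler_pM2l f0) mulrA; apply: le_trans h.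
  rewrite mulrBr mulrC divfK ?gt_eqF// lerD2l lerN2 -mulrA.
  have -> : n%:R `^ (- (r.+2%:R / m.+1%:R)) * n%:R `^ s = n%:R `^ (-
    m.+1%:R^-1) :> R.
    rewrite -powRD; last by rewrite (gt_eqF nR) implybT.
    congr (_ `^ _); rewrite /s -[r.+2]addn1 natrD mulrDl mul1r.
    by rewrite opprD addrAC addNr add0r.
  rewrite mulrC -ler_pdivlMr//.
  near: n.
  have h : 0 < r`!%:R * e / C by apply: divr_gt0 => //; exact: mulr_gt0.
  have /cvgrPdist_le/(_ _ h) := @cvg_powRN m.+1%:R^-1 ltac:(by rewrite
    invr_gt0).
  apply: filterS => n; rewrite sub0r normrN ger0_norm ?powR_ge0//.
(* Upper side: half of e pays for the factor e^(delta s) in the main term, the other half for the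
   exponentially small remainder. *)
have := record_mean_le m r n delta n0 (ltW delta0).
rewrite stretched_meanE ?expR_gt0// -/B -/s deltaE.
move=> /(ler_wpM2r (powR_ge0 n%:R s)).
rewrite mulrDl -[_ * _ * n%:R `^ s in X in X + _]mulrA ns mulr1 => h.
rewrite -(ler_pM2l f0) mulrA; apply: (le_trans h).
rewrite [leRHS]mulrDr [in leRHS](mulrC _ (B / _)) divfK ?gt_eqF//.
rewrite mulrDr mulr1 -addrA lerD2l.
have -> : B * (r`!%:R * e / (2 * B)) = r`!%:R * (e / 2).
  by field; rewrite gt_eqF.
rewrite -mulrA -mulrDr ler_pM2l// -lerBrDl.
(* Since s <= 1, n^s is at most n. *)
apply: (@le_trans _ _ (expR (- D) ^+ n * n%:R)).
  apply: ler_pM.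
  - by rewrite exprn_ge0// erlang_tail_ge0// ltW.
  - exact: powR_ge0.
  - rewrite lerXn2r ?nnegrE ?expR_ge0 ?erlang_tail_ge0 ?(ltW delta0)//.
    by rewrite erlang_tail_le_expR// ltW.
  - by rewrite ler1_powR// ler1n.
apply: (le_trans (expRN_mul_le n D D0 n0)).
rewrite ler_pdivrMr// [leRHS]mulrC -ler_pdivrMr; last by lra.
near: n; exact: nbhs_infty_ger.
Unshelve. all: by end_near. Qed.

End record_mean_limit.

(** * The Stolz-Cesaro theorem and its comparison sequences *)

Section stolz.
Context {R : realType}.
Implicit Types (a b : nat -> R) (l s : R).

(** Past some rank each step changes S - l b by at most e/2 times the increment of b, and these
    errors telescope. Growth is asked only from n = 1 because ln 0 = ln 1 = 0 here. *)
Lemma stolz_cesaro a b l :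
  (forall n, (0 < n)%N -> b n < b n.+1) -> b n @[n --> \oo] --> +oo%R ->
  a n / (b n.+1 - b n) @[n --> \oo] --> l ->
  (\sum_(j < n) a j) / b n @[n --> \oo] --> l.
Proof.
move=> b_incr b_oo abl; apply/cvgrPdist_le => e e0.
have e20 : 0 < e / 2 by rewrite divr_gt0.
have /cvgrPdist_le/(_ _ e20)[M _ HM] := abl.
pose N := M.+1; pose S n := \sum_(j < n) a j.
have bound i : `|S (N + i)%N - l * b (N + i)%N| <=
    `|S N - l * b N| + e / 2 * (b (N + i)%N - b N).
  elim: i => [|i IH]; first by rewrite addn0 subrr mulr0 addr0.
  set n := (N + i)%N in IH *; rewrite addnS -/n.
  have d0 : 0 < b n.+1 - b n by rewrite subr_gt0 b_incr.
  have -> : S n.+1 - l * b n.+1 =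
      (S n - l * b n) + (a n / (b n.+1 - b n) - l) * (b n.+1 - b n).
    by rewrite /S big_ord_recr/=; field; rewrite gt_eqF.
  apply: (le_trans (ler_normD _ _)).
  have := HM n; rewrite /= distrC => /(_ _) h.
  have {}h : `|a n / (b n.+1 - b n) - l| <= e / 2.
    by apply: h; rewrite /n /N addSn leqW// leq_addr.
  rewrite normrM (gtr0_norm d0).
  have := ler_wpM2r (ltW d0) h; lra.
(* All that depends on the starting rank, with an absolute value as [b N] may be negative; it is
   absorbed by the other e/2 since b tends to +oo. *)
pose C := `|S N - l * b N| + e / 2 * `|b N|.
have C0 : 0 <= C by rewrite addr_ge0// mulr_ge0// ltW.
near=> n.
have bn0 : 0 < b n by near: n; move/cvgryPgt : b_oo; exact.
have Cb : C <= e / 2 * b n.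
  rewrite mulrC -ler_pdivrMr//; near: n; move/cvgryPge : b_oo; exact.
have Nn : (N <= n)%N by near: n; exact: nbhs_infty_ge.
have := bound (n - N)%N; rewrite subnKC// => h.
have -> : l - S n / b n = - ((S n - l * b n) / b n) by field; rewrite gt_eqF.
rewrite normrN normrM [X in _ * X]gtr0_norm ?invr_gt0// ler_pdivrMr//.
apply: (le_trans h).
have : - (e / 2 * b N) <= e / 2 * `|b N|.
  by rewrite -mulrN ler_wpM2l ?(ltW e20)// -normrN ler_norm.
by move: Cb; rewrite /C; lra.
Unshelve. all: by end_near. Qed.

(** The mean value theorem for a function with nonincreasing derivative, shared by the power and the
    logarithm. *)
Lemma increment_bounds (f df : R -> R) (x : R) : 0 < x ->
  (forall y : R, 0 < y -> is_derive y 1 f (df y)) ->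
  (forall y z : R, 0 < y -> y <= z -> df z <= df y) ->
  df (x + 1) <= f (x + 1) - f x <= df x.
Proof.
move=> x0 fdf dfdecr.
have x1 : x <= x + 1 by rewrite lerDl.
have [y /[!in_itv]/= /andP[xy _]||c] := @MVT_segment R f df x (x + 1) x1.
- by apply: fdf; exact: lt_trans xy.
- apply: derivable_within_continuous => y /[!in_itv]/= /andP[xy _].
  by have [] := fdf y (lt_le_trans x0 xy).
rewrite in_itv/= => /andP[xc cx] ->.
rewrite addrAC subrr add0r mulr1 !dfdecr//.
exact: lt_le_trans xc.
Qed.

Lemma cvg_ratio_succ : n%:R / n.+1%:R @[n --> \oo] --> (1 : R).
Proof.
rewrite (_ : (fun n => _) = (fun n => 1 - (n.+1%:R^-1 : R))); last first.
  apply/funext => n; have nE : n%:R = n.+1%:R - 1 :> R by rewrite -natr1 addrK.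
  by rewrite nE mulrBl divff ?pnatr_eq0// mul1r.
rewrite -[X in _ --> X]subr0; apply: cvgB; first exact: cvg_cst.
exact: cvg_harmonic.
Qed.

Lemma cvg_powR_increment s : 0 < s < 1 ->
  (n.+1%:R `^ (1 - s) - n%:R `^ (1 - s)) * n%:R `^ s @[n --> \oo] --> 1 - s.
Proof.
move=> /andP[s0 s1]; have s10 : 0 < 1 - s by rewrite subr_gt0.
(* The derivative at n+1 gives (1-s) (n/(n+1))^s; as s <= 1 and the ratio is at most 1, dropping the
   power s only lowers it. *)
apply: (@squeeze_cvgr _ _ _ _ (fun n => (1 - s) * (n%:R / n.+1%:R)) (fun=> 1 -
  s)).
- near=> n.
  have n0 : (0 < n)%N by near: n; exact: nbhs_infty_gt.
  have nR : (0 : R) < n%:R by rewrite ltr0n.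
  have /andP[lo hi] := @increment_bounds (fun x => x `^ (1 - s))
    (fun x => (1 - s) * x `^ (1 - s - 1)) n%:R nR
    (fun y y0 => is_derive1_powR (1 - s) y0) ltac:(
      move=> y z y0 yz; rewrite ler_wpM2l ?(ltW s10)// addrAC subrr add0r
        !powRN;
      rewrite lef_pV2 ?posrE ?powR_gt0 ?(lt_le_trans y0 yz)//;
      by rewrite ge0_ler_powR ?nnegrE ?(ltW s0) ?(ltW y0) ?(le_trans (ltW y0)
        yz)).
  move: lo hi; rewrite addrAC subrr add0r natr1 => lo hi.
  have ns0 : 0 < n%:R `^ s by rewrite powR_gt0.
  apply/andP; split; last first.
    by rewrite -ler_pdivlMr// -powRN.
  apply: (@le_trans _ _ ((1 - s) * n.+1%:R `^ (- s) * n%:R `^ s)); last first.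
    by rewrite ler_pM2r.
  rewrite -mulrA ler_pM2l// powRN [leRHS]mulrC.
  have -> : n%:R `^ s / n.+1%:R `^ s = (n%:R / n.+1%:R) `^ s :> R.
    rewrite powRM// -[n.+1%:R^-1]powR_inv1// -powRrM mulN1r.
    by rewrite powRN.
  rewrite ger1_powR ?(ltW s1)// divr_gt0//=.
  by rewrite ler_pdivrMr// mul1r ler_nat.
- rewrite -[X in _ --> X]mulr1; apply: cvgM; first exact: cvg_cst.
  exact: cvg_ratio_succ.
- exact: cvg_cst.
Unshelve. all: by end_near. Qed.

Lemma cvg_ln_increment :
  (ln n.+1%:R - ln n%:R) * n.+1%:R @[n --> \oo] --> (1 : R).
Proof.
apply: (@squeeze_cvgr _ _ _ _ (fun=> 1) (fun n => 1 + n%:R^-1)).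
- near=> n.
  have n0 : (0 < n)%N by near: n; exact: nbhs_infty_gt.
  have nR : (0 : R) < n%:R by rewrite ltr0n.
  have /andP[lo hi] := @increment_bounds (@ln R) (fun x => x^-1) n%:R nR
    (fun y y0 => is_derive1_ln y0) ltac:(
      by move=> y z y0 yz; rewrite lef_pV2 ?posrE// (lt_le_trans y0 yz)).
  move: lo hi; rewrite natr1 => lo hi; apply/andP; split.
    by rewrite -ler_pdivrMr// mul1r.
  rewrite -ler_pdivlMr// (le_trans hi)// ler_pdivlMr//.
  by rewrite -natr1 mulrDr mulr1 mulVf ?gt_eqF.
- exact: cvg_cst.
- rewrite -[X in _ --> X]addr0; apply: cvgD; first exact: cvg_cst.
  apply/(@gtr0_cvgV0 _ _ _ _ (fun n : nat => n%:R)); last exact: cvgr_idn.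
  by near=> n; rewrite ltr0n; near: n; exact: nbhs_infty_gt.
Unshelve. all: by end_near. Qed.

Lemma cvg_powR_pinfty s : 0 < s -> (n%:R : R) `^ s @[n --> \oo] --> +oo%R.
Proof.
move=> s0; rewrite (_ : (fun n => _) = (fun n => ((n%:R : R) `^ (- s))^-1)).
  apply/cvgrVy; last exact: cvg_powRN.
  by near=> n; rewrite powR_gt0// ltr0n; near: n; exact: nbhs_infty_gt.
by apply/funext => n; rewrite powRN invrK.
Unshelve. all: by end_near. Qed.

Lemma cvg_ln_pinfty : ln (n%:R : R) @[n --> \oo] --> +oo%R.
Proof.
apply/cvgryPge => A; near=> n.
have : expR A <= n%:R by near: n; exact: nbhs_infty_ger.
by move=> h; rewrite -[leLHS]expRK ler_ln ?posrE ?expR_gt0// (lt_le_trans _ h)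
  ?expR_gt0.
Unshelve. all: by end_near. Qed.

(** The terms a_n are compared with the increments of n^(1-s), equivalent to (1-s) n^(-s): hence the
    factor 1/(1-s). *)
Lemma sum_powR_cvg a s l : 0 < s < 1 ->
  a n * n%:R `^ s @[n --> \oo] --> l ->
  (\sum_(j < n) a j) / n%:R `^ (1 - s) @[n --> \oo] --> l / (1 - s).
Proof.
move=> s01 al; have /andP[s0 s1] := s01.
apply: stolz_cesaro.
- move=> n n0; apply: gt0_ltr_powR; rewrite ?subr_gt0 ?nnegrE//.
  by rewrite ltr_nat.
- by apply: cvg_powR_pinfty; rewrite subr_gt0.
- have s1N0 : 1 - s != 0 by rewrite subr_eq0 gt_eqF.
  apply: cvg_trans (cvgM al (cvgV s1N0 (cvg_powR_increment s s01))).
  apply: near_eq_cvg; near=> n.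
  have n0 : (0 < n)%N by near: n; exact: nbhs_infty_gt.
  have ns0 : n%:R `^ s != 0 :> R by rewrite gt_eqF// powR_gt0// ltr0n.
  by rewrite /= invfM [_^-1 / _]mulrC mulrA mulfK.
Unshelve. all: by end_near. Qed.

Lemma asymp_eq_scale a b l : l != 0 -> a n / b n @[n --> \oo] --> l ->
  asymp_eq a (fun n => l * b n).
Proof.
move=> l0 abl; rewrite /asymp_eq.
rewrite (_ : (fun n => _) = (fun n => a n / b n * l^-1)); last first.
  by apply/funext => n; rewrite invfM mulrA mulrAC.
by rewrite -[X in _ --> X](divff l0); apply: cvgM => //; exact: cvg_cst.
Qed.

Lemma asymp_eq_common a b c l : l != 0 -> (\forall n \near \oo, c n != 0) ->
  a n / c n @[n --> \oo] --> l -> b n / c n @[n --> \oo] --> l -> asymp_eq a b.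
Proof.
move=> l0 c0 acl bcl; rewrite /asymp_eq -[X in _ --> X](divff l0).
apply: cvg_trans (cvgM acl (cvgV l0 bcl)).
apply: near_eq_cvg; near=> n.
have cn0 : c n != 0 by near: n.
by rewrite /= invfM invrK mulrA mulrAC mulfVK.
Unshelve. all: by end_near. Qed.

End stolz.

(** * Asymptotics of the expectations *)

Section asymptotics.
Context {d} {Omega : measurableType d} {R : realType} {P : probability Omega R}.
Variables (T : nat -> nat -> {RV P >-> R}) (hT : iid_exp1 T).

(** The factor 1/(1-s) contributed by summation cancels the 1/(m+1) of [record_const] and leaves
    1/(k-r). *)
Lemma kcut_etaE m r : (r < m)%N ->
  kcut_eta R m.+1 r.+1 =
  record_const m r / r`!%:R / (1 - r.+1%:R / m.+1%:R).
Proof.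
move=> rm; rewrite /kcut_eta Gamma_fact /record_const.
have f0 : (r`!%:R : R) != 0 by rewrite pnatr_eq0 -lt0n fact_gt0.
have m0 : (m.+1%:R : R) != 0 by rewrite pnatr_eq0.
have mr0 : (m.+1%:R - r.+1%:R : R) != 0 by rewrite subr_eq0 eqr_nat gtn_eqF.
set s := _ / m.+1%:R; set a := _ `^ s; set g := Gamma s.
rewrite (_ : 1 - s = (m.+1%:R - r.+1%:R) / m.+1%:R); last first.
  by rewrite mulrBl divff.
move: (m.+1%:R : R) (r.+1%:R : R) @s @a @g m0 mr0 => M r' s a g m0 mr0.
by field; rewrite m0 f0 mr0.
Qed.

Lemma kcut_eta_gt0 m r : (r < m)%N -> 0 < kcut_eta R m.+1 r.+1.
Proof.
move=> rm; rewrite kcut_etaE//.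
rewrite !divr_gt0 ?record_const_gt0 ?ltr0n ?fact_gt0// subr_gt0.
by rewrite ltr_pdivrMr// mul1r ltr_nat.
Qed.

Lemma ratio_itv01 m r : (r < m)%N -> 0 < (r.+1%:R / m.+1%:R : R) < 1.
Proof. by move=> rm; rewrite divr_gt0//= ltr_pdivrMr// mul1r ltr_nat. Qed.

Lemma mean_records_cvg m r : (r < m)%N ->
  mean_records T m.+1 n r.+1 / n%:R `^ (1 - r.+1%:R / m.+1%:R) @[n --> \oo] -->
  kcut_eta R m.+1 r.+1.
Proof.
move=> rm; rewrite kcut_etaE//.
under eq_fun do rewrite (mean_recordsE T hT).
apply: sum_powR_cvg; first exact: ratio_itv01.
exact: record_mean_cvg (ltnW rm).
Qed.

Lemma mean_records_last_cvg m :
  mean_records T m.+1 n m.+1 / ln n%:R @[n --> \oo] --> (1 : R).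
Proof.
under eq_fun do rewrite (mean_recordsE T hT).
apply: stolz_cesaro.
- by move=> n n0; rewrite ltr_ln ?posrE ?ltr0n// ltr_nat.
- exact: cvg_ln_pinfty.
- rewrite -[X in _ --> X]invr1; under eq_fun do rewrite record_mean_last -invfM
    mulrC.
  by apply: cvgV => //; exact: cvg_ln_increment.
Qed.

(** Under the normalization of the 1-records, the terms equal a convergent sequence times
    n^(-r/(m+1)), so they rescale to 0. The case r = m covers the logarithmic order. *)
Lemma mean_records_negligible m r : (0 < r <= m)%N ->
  mean_records T m.+1 n r.+1 / n%:R `^ (1 - 1 / m.+1%:R) @[n --> \oo] --> (0 :
    R).
Proof.
move=> /andP[r0 rm]; have m0 : (0 < m)%N by exact: leq_trans rm.
rewrite -(mul0r (1 - 1 / m.+1%:R)^-1).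
under eq_fun do rewrite (mean_recordsE T hT).
apply: sum_powR_cvg; first exact: (ratio_itv01 m 0).
have rs : (0 : R) < r%:R / m.+1%:R by rewrite divr_gt0 ?ltr0n.
rewrite -[X in _ --> X](mulr0 (record_const m r / r`!%:R)).
apply: cvg_trans (cvgM (@record_mean_cvg R m r rm) (cvg_powRN _ rs)).
apply: near_eq_cvg; near=> n.
have n0 : (0 < n)%N by near: n; exact: nbhs_infty_gt.
rewrite /= -mulrA; congr (_ * _).
rewrite -powRD; last by rewrite pnatr_eq0 (gtn_eqF n0) implybT.
by congr (_ `^ _); rewrite -mulrBl -natrB// subSnn.
Unshelve. all: by end_near. Qed.

Lemma mean_kcut_cvg m : (0 < m)%N ->
  mean_kcut T m.+1 n / n%:R `^ (1 - 1 / m.+1%:R) @[n --> \oo] -->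
  kcut_eta R m.+1 1.
Proof.
move=> m0.
rewrite (_ : (fun n => _) = (fun n =>
  mean_records T m.+1 n 1 / n%:R `^ (1 - 1 / m.+1%:R) +
  \sum_(r < m) mean_records T m.+1 n r.+2 / n%:R `^ (1 - 1 / m.+1%:R)));
    last first.
  by apply/funext => n; rewrite (mean_kcutE T hT) big_ord_recl mulrDl mulr_suml.
rewrite -[X in _ --> X]addr0; apply: cvgD; first exact: (mean_records_cvg m 0
  m0).
rewrite -[X in _ --> X](@big1_eq _ _ +%R _ (index_enum 'I_m) xpredT).
apply: cvg_big => [|r _]; first exact: add_continuous.
by apply: mean_records_negligible; rewrite /= ltn_ord.
Qed.

Lemma mean_kcut_asymp k : (1 <= k)%N ->
  asymp_eq (fun n => mean_kcut T k n) (fun n => mean_records T k n 1).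
Proof.
case: k => [//|[|m]] _.
  (* For k = 1 both sides count the same records, of logarithmic growth; for k >= 2 the common scale
     is n^(1-1/k). *)
  apply: (@asymp_eq_common R _ _ (fun n => ln n%:R) 1 (oner_neq0 _)).
  - near=> n; rewrite gt_eqF// ln_gt0// ltr1n; near: n; exact: nbhs_infty_gt.
  - under eq_fun do rewrite (mean_kcutE T hT) big_ord1.
    exact: mean_records_last_cvg.
  - exact: mean_records_last_cvg.
apply: (@asymp_eq_common R _ _ (fun n => n%:R `^ (1 - 1 / m.+2%:R))
  (kcut_eta R m.+2 1)).
- by rewrite gt_eqF// kcut_eta_gt0.
- near=> n; rewrite gt_eqF// powR_gt0// ltr0n; near: n; exact: nbhs_infty_gt.
- exact: mean_kcut_cvg.
- exact: (mean_records_cvg m.+1 0).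
Unshelve. all: by end_near. Qed.

End asymptotics.

Lemma kcut_eta21 (R : realType) : kcut_eta R 2 1 = Num.sqrt (2 * pi).
Proof.
rewrite /kcut_eta mul1r Gamma_half (_ : 1%:R = 1%N%:R :> R)// Gamma_fact divr1.
rewrite powR12_sqrt// -natrB// divr1 -sqrtrM//.
Qed.

Theorem theorem1 (d : measure_display) (Omega : measurableType d)
    (R : realType) (P : probability Omega R)
    (T : nat -> nat -> {RV P >-> R}) (hT : iid_exp1 T)
    (k : nat) (hk : (1 <= k)%N) :
  (forall r : nat, (1 <= r)%N -> (r < k)%N ->
     asymp_eq (fun n => mean_records T k n r)
              (fun n => kcut_eta R k r * n%:R `^ (1 - r%:R / k%:R))) /\
  asymp_eq (fun n => mean_records T k n k) (fun n => ln (n%:R : R)) /\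
  asymp_eq (fun n => mean_kcut T k n) (fun n => mean_records T k n 1) /\
  (k = 2%N ->
     asymp_eq (fun n => mean_kcut T k n) (fun n => mean_records T k n 1) /\
     asymp_eq (fun n => mean_records T k n 1)
              (fun n => Num.sqrt (2 * pi * n%:R : R))).
Proof.
have part1 r : (1 <= r)%N -> (r < k)%N ->
    asymp_eq (fun n => mean_records T k n r)
             (fun n => kcut_eta R k r * n%:R `^ (1 - r%:R / k%:R)).
  case: r k hk => [//|r] [//|m] _ _ rm; apply: asymp_eq_scale.
    by rewrite gt_eqF// kcut_eta_gt0.
  exact: mean_records_cvg.
split; first exact: part1.
split; first by case: k hk {part1} => // m _; exact: mean_records_last_cvg.
split; first exact: mean_kcut_asymp.
move=> k2; split; first exact: mean_kcut_asymp.
have := part1 1%N isT; rewrite k2 => /(_ isT).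
rewrite (_ : (fun n => kcut_eta _ _ _ * _) = (fun n => Num.sqrt (2 * pi * n%:R
  : R)))//.
apply/funext => n; rewrite kcut_eta21.
rewrite (_ : 1 - 1 / 2 = 2^-1 :> R); last by field.
by rewrite powR12_sqrt// -sqrtrM// mulr_ge0// pi_ge0.
Qed.
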